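(* There exists $n_0$ such that for every $n \geq n_0$ the following holds. If $\mathcal{A}, \mathcal{B} \subset S_n$ is a cross-intersecting pair of families which are not both contained within the same 1-coset, then \[|\mathcal{A}||\mathcal{B}| \leq \big((n-1)! - d_{n-1} - d_{n-2}\big)\big((n-1)! + 1\big),\] with equality if and only if \[\mathcal{A} = \{\sigma \in S_n : \sigma(i) = j,\ \sigma \text{ intersects } \rho\}, \qquad \mathcal{B} = \{\sigma \in S_n : \sigma(i) = j\} \cup \{\rho\}\] for some $i, j \in [n]$ and some $\rho \in S_n$ with $\rho(i) \neq j$.
   Context: $S_n$ is the symmetric group on $[n]=\{1,\ldots,n\}$. Two permutations $\sigma,\rho$ intersect if $\sigma(k)=\rho(k)$ for some $k\in[n]$. A pair of families $\mathcal{A},\mathcal{B} \subset S_n$ is cross-intersecting if every $\sigma \in \mathcal{A}$ intersects every $\tau \in \mathcal{B}$. A 1-coset of $S_n$ is a set of the form $\{\sigma \in S_n : \sigma(i)=j\}$ for some $i,j\in[n]$. $d_m$ denotes the number of derangements (fixed-point-free permutations) of an $m$-element set.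
   Formalization: The equality case is stated up to exchanging A and B: since the product and the hypotheses are symmetric, the pair with the roles of A and B swapped also attains equality, so the literal ''only if'' with fixed roles would be false. *)

(* Defs.v *)
From mathcomp Require Import all_boot all_fingroup.
Set Implicit Arguments. Unset Strict Implicit. Unset Printing Implicit Defensive.

(* S_n is {perm 'I_n}; [n] is represented by 'I_n = {0,...,n-1}. *)

Definition intersect n (s r : {perm 'I_n}) : bool := [exists k, s k == r k].

Definition cross_intersecting n (A B : {set {perm 'I_n}}) : Prop :=
  forall s t, s \in A -> t \in B -> intersect s t.

Definition one_coset n (i j : 'I_n) : {set {perm 'I_n}} := [set s : {perm 'I_n} | s i == j].

Definition derangements (m : nat) : nat :=
  #|[set s : {perm 'I_m} | [forall k, s k != k]]|.

Definition extA n (i j : 'I_n) (r : {perm 'I_n}) : {set {perm 'I_n}} :=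
  [set s : {perm 'I_n} | (s i == j) && intersect s r].
Definition extB n (i j : 'I_n) (r : {perm 'I_n}) : {set {perm 'I_n}} :=
  one_coset i j :|: [set r].

(* Main.v *)
Require Import Defs.
From mathcomp Require Import all_boot all_order all_fingroup all_algebra.
From mathcomp Require Import ring lra zify.
Set Implicit Arguments. Unset Strict Implicit. Unset Printing Implicit Defensive.
Import Order.TTheory GRing.Theory Num.Theory.

(** Let [agr s t] be the number of agreements of [s] and [t].  If [A] and [B]
    are cross-intersecting then [(1 - x)(2 - x)(3 - x) <= 0] for [x = agr s t]
    whenever [s] is in [A] and [t] is in [B].  Up to the kernel
    [1 - 3x + 3x(x-1) - x(x-1)(x-2)], which kills the span [U] of the indicators
    of 1-cosets and has norm [O((n-2)!)] on its orthogonal complement, this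
    polynomial is affine in [x].  Summing over [A * B] therefore bounds the
    correlation of the level-one parts (the projections to [U]) of the two
    indicators from below.  Two consequences follow.  First, [|A| |B|] is at most
    [36 (n-1)!^2].  Second, when [|A| |B|] is of order [(n-1)!^2], the smaller
    family has large level-one weight, and a fourth-moment bound for
    [s |-> sum_i y i (s i)] forces it to have positive density in some 1-coset.
    The product bound in [S_(n-1)], applied to the parts [i -> j] of [A] and
    [i -> k] of [B] for [j <> k], then pushes almost all of both families into
    the same 1-coset, and the extremal problem becomes a count of the
    permutations of a coset meeting one or two given permutations outside it. *)

(** * Permutations with prescribed values, and 1-cosets as copies of a smaller symmetric group *)

Section Counting.

(** The list [c] of (position, value) pairs encodes a partial map, which is a partial injection once
    [unzip1 c] and [unzip2 c] are duplicate-free. *)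
Definition extends n (c : seq ('I_n * 'I_n)) (s : {perm 'I_n}) : bool :=
  all (fun p => s p.1 == p.2) c.

Lemma extends_val n (c : seq ('I_n * 'I_n)) s l :
  extends c s -> l \in unzip2 c -> exists2 k, k \in unzip1 c & s k = l.
Proof.
move=> /allP h /mapP[p pc ->]; exists p.1; first exact: map_f.
by apply/eqP; exact: h.
Qed.

Lemma card_extends n (c : seq ('I_n * 'I_n)) :
  uniq (unzip1 c) -> uniq (unzip2 c) ->
  #|[set s : {perm 'I_n} | extends c s]| = (n - size c)`!.
Proof.
elim: c => [|[k l] c IH] /=.
  move=> _ _; rewrite subn0 (_ : [set s | _] = [set: {perm 'I_n}]).
    by rewrite cardsT card_Sn.
  by apply/setP => s; rewrite !inE.
case/andP => kc uc1 /andP[lc uc2]; move: (IH uc1 uc2) => {}IH.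
have un : (size c < n)%N.
  have /card_uniqP : uniq (k :: unzip1 c) by rewrite /= kc.
  by have := max_card (mem (k :: unzip1 c)); rewrite card_ord => + e; rewrite e /= size_map.
have eqc l' : l' \notin unzip2 c ->
  #|[set s : {perm 'I_n} | extends ((k, l') :: c) s]| =
  #|[set s : {perm 'I_n} | extends ((k, l) :: c) s]|.
  move=> l'c.
  have sub x y : x \notin unzip2 c -> y \notin unzip2 c ->
     (#|[set s : {perm 'I_n} | extends ((k, x) :: c) s]| <=
      #|[set s : {perm 'I_n} | extends ((k, y) :: c) s]|)%N.
    move=> xc yc.
    rewrite -(card_imset _ (mulIg (tperm x y))).
    apply/subset_leq_card/subsetP => _ /imsetP[s + ->].
    rewrite !inE /= => /andP[/eqP sk /allP h].
    rewrite permM sk tpermL eqxx /=; apply/allP => p pc.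
    rewrite permM (eqP (h p pc)) tpermD //.
      by apply: contraNneq xc => ->; exact: map_f.
    by apply: contraNneq yc => ->; exact: map_f.
  by apply/eqP; rewrite eqn_leq !sub.
have : (n - size c)`! = ((n - size c) *
    #|[set s : {perm 'I_n} | extends ((k, l) :: c) s]|)%N.
  rewrite -IH -sum1dep_card (partition_big (fun s : {perm 'I_n} => s k) predT) //=.
  rewrite (bigID (fun l' => l' \in unzip2 c)) /= big1 ?add0n.
    rewrite (eq_bigr (fun=> #|[set s : {perm 'I_n} | extends ((k, l) :: c) s]|)).
      rewrite sum_nat_const; congr (_ * _)%N.
      move/card_uniqP: uc2; rewrite size_map => uc2.
      have := cardC (mem (unzip2 c)); rewrite card_ord uc2 => e.
      rewrite -[X in (X - _)%N]e addKn.
      by apply: eq_card => x; rewrite !inE.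
    move=> l' /eqc <-; rewrite -sum1dep_card; apply: eq_bigl => s.
    by rewrite /extends /= andbC.
  move=> l' l'c; apply: big1 => s /andP[cs /eqP sk].
  have [k' k'c sk'] := extends_val cs l'c.
  by move: kc; rewrite -sk in sk'; rewrite -(perm_inj sk') k'c.
have -> : (n - size c)`! = ((n - size c) * (n - (size c).+1)`!)%N.
  by rewrite subnS; case: (n - size c)%N (subn_gt0 (size c) n) => [|m _]; rewrite ?un // factS.
by move/eqP; rewrite eqn_pmul2l ?subn_gt0 // => /eqP ->.
Qed.

Lemma card_one_coset n (i j : 'I_n.+1) : #|one_coset i j| = n`!.
Proof.
have := @card_extends n.+1 [:: (i, j)] isT isT; rewrite subn1 /= => <-.
by apply: eq_card => s; rewrite !inE /extends /= andbT.
Qed.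

Lemma lift_perm_inj n (i j : 'I_n.+1) : injective (lift_perm i j).
Proof.
move=> s t h; apply/permP => k; apply: (@lift_inj _ j).
by rewrite -!(lift_perm_lift i) h.
Qed.

(** This identifies a 1-coset with the symmetric group of one degree less; the inductions on the
    degree go through it. *)
Lemma imset_lift_perm n (i j : 'I_n.+1) :
  [set lift_perm i j s | s : {perm 'I_n}] = one_coset i j.
Proof.
apply/eqP; rewrite eqEcard; apply/andP; split.
  by apply/subsetP => _ /imsetP[s _ ->]; rewrite inE lift_perm_id.
by rewrite card_one_coset card_imset ?card_Sn //; exact: lift_perm_inj.
Qed.

Lemma lift_permP n (i j : 'I_n.+1) (s : {perm 'I_n.+1}) :
  s i = j -> exists t, s = lift_perm i j t.
Proof.
move=> sij; have : s \in one_coset i j by rewrite inE sij.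
by rewrite -imset_lift_perm => /imsetP[t _ ->]; exists t.
Qed.

End Counting.

(** * Agreement kernels and their action on the span [U] of the 1-cosets *)

Section Kernels.
Local Open Scope ring_scope.

Definition agr n (s t : {perm 'I_n}) : nat := \sum_k (s k == t k).

Definition marg n (f : {perm 'I_n} -> rat) (i j : 'I_n) : rat :=
  \sum_(s : {perm 'I_n} | s i == j) f s.

Definition restr n (f : {perm 'I_n.+1} -> rat) (i j : 'I_n.+1) :
  {perm 'I_n} -> rat := fun s => f (lift_perm i j s).

(* This is [k!] times the sum, over all partial injections of size [k], of the
   products of the masses that [f] and [g] give to their extensions. *)
Definition kform k n (f g : {perm 'I_n} -> rat) : rat :=
  \sum_s \sum_t f s * g t * ((agr s t) ^_ k)%:R.

(** The functions [lin z] are the elements of [U]; in general [z] is not determined by the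
    function. *)
Definition lin n (z : 'I_n -> 'I_n -> rat) (s : {perm 'I_n}) : rat :=
  \sum_i z i (s i).

Lemma sum_lift_perm n (f : {perm 'I_n.+1} -> rat) i j :
  \sum_(s : {perm 'I_n.+1} | s i == j) f s = \sum_s f (lift_perm i j s).
Proof.
rewrite (eq_bigl (fun s => s \in one_coset i j)); last by move=> s; rewrite inE.
rewrite -imset_lift_perm big_imset //=.
by move=> s t _ _; exact: lift_perm_inj.
Qed.

Lemma sum_restr n (f : {perm 'I_n.+1} -> rat) i j :
  \sum_s restr f i j s = marg f i j.
Proof. by rewrite /marg sum_lift_perm. Qed.

Lemma sum_marg_r n (f : {perm 'I_n} -> rat) i : \sum_j marg f i j = \sum_s f s.
Proof. by rewrite [RHS](partition_big (fun s : {perm 'I_n} => s i) predT). Qed.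

Lemma sum_marg_l n (f : {perm 'I_n} -> rat) j : \sum_i marg f i j = \sum_s f s.
Proof.
rewrite /marg (exchange_big_dep predT) //=; apply: eq_bigr => s _.
rewrite (big_pred1 (s^-1%g j)) // => i /=.
by rewrite -(inj_eq (@perm_inj _ s) i) permKV.
Qed.

Lemma sum_lin_marg n (f : {perm 'I_n} -> rat) z :
  \sum_s f s * lin z s = \sum_i \sum_j z i j * marg f i j.
Proof.
rewrite /lin; under eq_bigr do rewrite mulr_sumr.
rewrite exchange_big /=; apply: eq_bigr => i _.
rewrite (partition_big (fun s : {perm 'I_n} => s i) predT) //=.
apply: eq_bigr => j _; rewrite /marg mulr_sumr.
by apply: eq_bigr => s /eqP ->; rewrite mulrC.
Qed.

Lemma marg_eq n (f g : {perm 'I_n} -> rat) i j : f =1 g -> marg f i j = marg g i j.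
Proof. by move=> fg; apply: eq_bigr. Qed.

Lemma margB n (f g : {perm 'I_n} -> rat) i j :
  marg (fun s => f s - g s) i j = marg f i j - marg g i j.
Proof. by rewrite /marg sumrB. Qed.

Lemma agr_lift n (i j : 'I_n.+1) s t :
  agr (lift_perm i j s) (lift_perm i j t) = (agr s t).+1.
Proof.
rewrite /agr (bigD1_ord i) //= !lift_perm_id eqxx add1n; congr _.+1.
by apply: eq_bigr => k _; rewrite !lift_perm_lift (inj_eq (@lift_inj _ _)).
Qed.

Lemma agr_mulg n (u v s t : {perm 'I_n}) :
  agr (u * s * v)%g (u * t * v)%g = agr s t.
Proof.
rewrite /agr [RHS](reindex_inj (@perm_inj _ u)) /=.
by apply: eq_bigr => k _; rewrite !permM (inj_eq perm_inj).
Qed.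

(** In [x ^_ k.+1 = x * x.-1 ^_ k] the factor [x] is expanded into the choice of an agreement
    [i -> j]; deleting it leaves one agreement less. *)
Lemma kform_rec k n (f g : {perm 'I_n.+1} -> rat) :
  kform k.+1 f g = \sum_i \sum_j kform k (restr f i j) (restr g i j).
Proof.
rewrite /kform.
under eq_bigr => s _ do under eq_bigr => t _ do
  rewrite ffactnS natrM {1}/agr natr_sum mulrA mulr_sumr mulr_suml.
under eq_bigr => s _ do rewrite exchange_big /=.
rewrite exchange_big /=; apply: eq_bigr => i _.
rewrite (partition_big (fun s : {perm 'I_n.+1} => s i) predT) //=.
apply: eq_bigr => j _; rewrite sum_lift_perm; apply: eq_bigr => s _.
rewrite (bigID (fun t : {perm 'I_n.+1} => t i == j)) /= [X in _ + X]big1 ?addr0.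
  rewrite sum_lift_perm; apply: eq_bigr => t _.
  by rewrite !lift_perm_id eqxx mulr1 agr_lift.
by move=> t tij; rewrite lift_perm_id eq_sym (negbTE tij) mulr0 mul0r.
Qed.

Lemma kform0 n (f g : {perm 'I_n} -> rat) : kform 0 f g = (\sum_s f s) * (\sum_s g s).
Proof.
rewrite /kform mulr_suml; apply: eq_bigr => s _; rewrite mulr_sumr.
by apply: eq_bigr => t _; rewrite ffactn0 mulr1.
Qed.

Lemma kform1 n (f g : {perm 'I_n} -> rat) :
  kform 1 f g = \sum_i \sum_j marg f i j * marg g i j.
Proof.
case: n f g => [|n] f g.
  rewrite big_ord0 /kform big1 // => s _; rewrite big1 // => t _.
  by rewrite /agr big_ord0 mulr0.
by rewrite kform_rec; under eq_bigr => i _ do under eq_bigr => j _ do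
  rewrite kform0 !sum_restr.
Qed.

(** Unfolding [kform_rec] down to [kform 0] exhibits a sum of squares. *)
Lemma kform_ge0 k n (f : {perm 'I_n} -> rat) : 0 <= kform k f f.
Proof.
elim: k n f => [|k IH] n f; first by rewrite kform0 -expr2 sqr_ge0.
case: n f => [|n] f.
  rewrite /kform sumr_ge0 // => s _; rewrite sumr_ge0 // => t _.
  by rewrite /agr big_ord0 mulr0.
by rewrite kform_rec; apply: sumr_ge0 => i _; apply: sumr_ge0.
Qed.

Lemma kformC k n (f g : {perm 'I_n} -> rat) : kform k f g = kform k g f.
Proof.
rewrite /kform exchange_big /=; apply: eq_bigr => s _; apply: eq_bigr => t _.
rewrite [f t * _]mulrC; congr (_ * (_ ^_ _)%:R).
by apply: eq_bigr => i _; rewrite eq_sym.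
Qed.

Lemma kformDl k n (f g h : {perm 'I_n} -> rat) c :
  kform k (fun s => f s + c * g s) h = kform k f h + c * kform k g h.
Proof.
rewrite /kform mulr_sumr -big_split /=; apply: eq_bigr => s _.
by rewrite mulr_sumr -big_split /=; apply: eq_bigr => t _; ring.
Qed.

Lemma kformDr k n (f g h : {perm 'I_n} -> rat) c :
  kform k h (fun s => f s + c * g s) = kform k h f + c * kform k h g.
Proof. by rewrite kformC kformDl !(kformC k h). Qed.

Lemma eq_kform k n (f f' g g' : {perm 'I_n} -> rat) :
  f =1 f' -> g =1 g' -> kform k f g = kform k f' g'.
Proof.
by move=> e e'; apply: eq_bigr => s _; apply: eq_bigr => t _; rewrite e e'.
Qed.

(** Discriminant of the nonnegative quadratic polynomial in [c] given by the form at [f + c g]. *)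
Lemma kform_CS k n (f g : {perm 'I_n} -> rat) :
  kform k f g ^+ 2 <= kform k f f * kform k g g.
Proof.
set p := kform k f f; set q := kform k f g; set r := kform k g g.
have pos c : 0 <= p + 2 * c * q + c ^+ 2 * r.
  have := kform_ge0 k (fun s => f s + c * g s).
  by rewrite kformDl !kformDr (kformC k g f) -/p -/q -/r; lra.
have r0 : 0 <= r := kform_ge0 k g.
have [r00|rn0] := eqVneq r 0.
  have [->|q0] := eqVneq q 0; first by rewrite r00 mulr0 expr0n.
  (* For [r = 0] the polynomial is affine in [c]; this choice gives it the value -1. *)
  have := pos (- (p + 1) / (2 * q)); rewrite r00.
  have -> : 2 * (- (p + 1) / (2 * q)) * q = - (p + 1) by field.
  by rewrite mulr0; lra.
have {}r0 : 0 < r by rewrite lt_def rn0.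
have := pos (- q / r).
have -> : p + 2 * (- q / r) * q + (- q / r) ^+ 2 * r = (p * r - q ^+ 2) / r by field.
by rewrite pmulr_lge0 ?invr_gt0 // subr_ge0.
Qed.

Lemma ksum_shift n (kappa : nat -> rat) (s : {perm 'I_n}) :
  \sum_t kappa (agr s t) = \sum_(t : {perm 'I_n}) kappa (agr 1%g t).
Proof.
rewrite (reindex_inj (mulgI s)) /=; apply: eq_bigr => t _.
by rewrite -[in LHS](agr_mulg s^-1%g 1%g) !mulg1 mulVg mulKg.
Qed.

Lemma kform_one k n : (k <= n)%N ->
  kform k (fun _ : {perm 'I_n} => 1) (fun=> 1) = (n`!)%:R ^+ 2.
Proof.
elim: k n => [|k IH] n.
  by rewrite kform0 !sumr_const card_Sn -expr2.
case: n => // n kn; rewrite kform_rec.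
under eq_bigr => i _ do under eq_bigr => j _ do rewrite IH //.
by rewrite !sumr_const card_ord -mulrnA -[LHS]mulr_natl factS !natrM; ring.
Qed.

(** By invariance the inner sum in [kform_one] does not depend on the outer permutation, so it is
    the total divided by n!. *)
Lemma ksum_ffact k n (s : {perm 'I_n}) : (k <= n)%N ->
  \sum_t ((agr s t) ^_ k)%:R = (n`!)%:R :> rat.
Proof.
move=> kn; have := kform_one kn; rewrite /kform.
have nz : (n`!)%:R != 0 :> rat by rewrite pnatr_eq0 -lt0n fact_gt0.
under eq_bigr => u _.
  under eq_bigr => t _ do rewrite !mul1r.
  rewrite (ksum_shift (fun x => (x ^_ k)%:R)) -(ksum_shift (fun x => (x ^_ k)%:R) s).
  over.
rewrite sumr_const card_Sn -[LHS]mulr_natl expr2 => /(mulfI nz) //.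
Qed.

Lemma ffactS_add x k : (x.+1 ^_ k.+1 = x ^_ k.+1 + k.+1 * x ^_ k)%N.
Proof.
rewrite ffactSS ffactnSr; have [kx|xk] := leqP k x; last by rewrite ffact_small // !muln0.
by nia.
Qed.

(** The involution [h] fixes [s], hence preserves the number of agreements with [s]. It exchanges
    the two cosets because neither [p] nor [p'] is [i]. *)
Lemma kcos_other n (kappa : nat -> rat) (s : {perm 'I_n}) i j j' :
  j != s i -> j' != s i ->
  \sum_(t : {perm 'I_n} | t i == j) kappa (agr s t) =
  \sum_(t : {perm 'I_n} | t i == j') kappa (agr s t).
Proof.
move=> ji j'i; set p := (s^-1)%g j; set p' := (s^-1)%g j'.
pose h t : {perm 'I_n} := (tperm p p' * t * tperm j j')%g.
have hK : involutive h by move=> t; rewrite /h !mulgA tperm2 mul1g -!mulgA tperm2 mulg1.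
have hs : h s = s.
  apply/permP => x; rewrite /h !permM; case: (tpermP p p' x) => [->|->|/eqP xp /eqP xp'].
  - by rewrite /p' permKV tpermR /p permKV.
  - by rewrite /p permKV tpermL /p' permKV.
  - rewrite tpermD //; apply/eqP => e; move: xp xp'; rewrite /p /p' e.
      by rewrite permK eqxx.
    by rewrite permK eqxx.
have ip : p != i by apply: contraNneq ji => <-; rewrite /p permKV.
have ip' : p' != i by apply: contraNneq j'i => <-; rewrite /p' permKV.
rewrite (reindex_inj (inv_inj hK)) /=; apply: eq_big => [t|t _].
  rewrite /h !permM (tpermD ip ip') -(inj_eq (@perm_inj _ (tperm j j'))) tpermK.
  by rewrite tpermL.
by rewrite -{1}hs /h agr_mulg.
Qed.

(** By [kcos_other] the sum takes only two values as [j] varies. The one at [j = s i] is computed by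
    deleting [i]; the other follows from the total (n+2)! over all [j]. *)
Lemma kcos k n (s : {perm 'I_n.+2}) i j : (k <= n.+1)%N ->
  \sum_(t : {perm 'I_n.+2} | t i == j) ((agr s t) ^_ k)%:R =
  (n`!)%:R * ((n.+1)%:R - k%:R) +
  (n`!)%:R * (k%:R * (n.+2)%:R) * (s i == j)%:R :> rat.
Proof.
move=> kn.
have e1 : \sum_(t : {perm 'I_n.+2} | t i == s i) ((agr s t) ^_ k)%:R =
          (n.+1`!)%:R * (1 + k%:R) :> rat.
  have [s' ->] := lift_permP (erefl (s i)); rewrite lift_perm_id sum_lift_perm.
  under eq_bigr => t _ do rewrite agr_lift.
  case: k kn => [|k] kn.
    by rewrite sumr_const card_Sn addr0 mulr1.
  under eq_bigr => t _ do rewrite ffactS_add natrD natrM.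
  rewrite big_split /= -mulr_sumr !ksum_ffact //; last exact: ltnW.
  by ring.
have nz : (n.+1)%:R != 0 :> rat by rewrite pnatr_eq0.
have [<-|sij] := eqVneq (s i) j.
  by rewrite e1 factS natrM mulr1; rewrite -!natr1; ring.
rewrite mulr0 addr0.
have := ksum_ffact s (leqW kn).
rewrite (partition_big (fun t : {perm 'I_n.+2} => t i) predT) //= (bigD1 (s i)) //=.
rewrite e1 (eq_bigr (fun=> \sum_(t : {perm 'I_n.+2} | t i == j) ((agr s t) ^_ k)%:R)).
  rewrite sumr_const cardC1 card_ord /= -[_ *+ n.+1]mulr_natl => h.
  apply: (mulfI nz); apply: (addrI ((n.+1`!)%:R * (1 + k%:R))); rewrite h.
  by rewrite (factS n.+1) (factS n) !natrM -!natr1; ring.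
move=> j' j's; apply: (@kcos_other _ (fun x => (x ^_ k)%:R)) => //.
by rewrite eq_sym.
Qed.

(** Each kernel sends [lin z] to a constant plus a multiple of [lin z], so it preserves [U]. Both
    coefficients are affine in [k], so a third difference in [k] annihilates them. *)
Lemma kform_lin k n (f : {perm 'I_n.+2} -> rat) z : (k <= n.+1)%N ->
  kform k f (lin z) =
  (n`!)%:R * ((n.+1)%:R - k%:R) * (\sum_i \sum_j z i j) * (\sum_s f s) +
  (n`!)%:R * (k%:R * (n.+2)%:R) * \sum_s f s * lin z s.
Proof.
move=> kn; rewrite /kform mulr_sumr mulr_sumr -big_split /=.
apply: eq_bigr => s _.
under eq_bigr => t _ do rewrite -mulrA.
rewrite -mulr_sumr.
have -> : \sum_t lin z t * ((agr s t) ^_ k)%:R =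
    (n`!)%:R * ((n.+1)%:R - k%:R) * (\sum_i \sum_j z i j) +
    (n`!)%:R * (k%:R * (n.+2)%:R) * lin z s; last by ring.
under eq_bigr => t _ do rewrite mulrC.
rewrite sum_lin_marg /marg.
under eq_bigr => i _ do under eq_bigr => j _ do rewrite kcos // mulrDr.
under eq_bigr => i _ do rewrite big_split /=.
rewrite big_split /=; congr (_ + _).
  under eq_bigr => i _ do rewrite -mulr_suml.
  by rewrite -mulr_suml; ring.
rewrite (eq_bigr (fun i => z i (s i) * ((n`!)%:R * (k%:R * (n.+2)%:R)))).
  by rewrite -mulr_suml /lin; ring.
move=> i _; rewrite (bigD1 (s i)) //= eqxx mulr1 big1 ?addr0 // => j js.
by rewrite eq_sym (negbTE js) !mulr0.
Qed.

End Kernels.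

(** * Sums over permutations with prescribed values, and tables with zero sums *)

Section ConditionalSums.
Local Open Scope ring_scope.

Lemma cond_sum1 n (c : seq ('I_n * 'I_n)) k (psi : 'I_n -> rat) :
  k \notin unzip1 c -> uniq (unzip1 c) -> uniq (unzip2 c) ->
  \sum_(s : {perm 'I_n} | extends c s) psi (s k) =
  ((n - (size c).+1)`!)%:R * \sum_(l | l \notin unzip2 c) psi l.
Proof.
move=> kc u1 u2; rewrite (partition_big (fun s : {perm 'I_n} => s k) predT) //=.
rewrite (bigID (fun l => l \in unzip2 c)) /= big1 ?add0r.
  rewrite mulr_sumr; apply: eq_bigr => l lc.
  rewrite (eq_bigr (fun=> psi l)); last by move=> s /andP[_ /eqP ->].
  rewrite sumr_const -[LHS]mulr_natl; congr (_%:R * _).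
  rewrite -(@card_extends _ ((k, l) :: c)) /= ?kc ?lc //.
  by apply: eq_card => s; rewrite !inE /extends unfold_in /= andbC.
move=> l lc; apply: big1 => s /andP[cs /eqP sk].
have [k' k'c sk'] := extends_val cs lc.
by move: kc; rewrite -sk in sk'; rewrite -(perm_inj sk') k'c.
Qed.

Lemma cond_sum2 n (c : seq ('I_n * 'I_n)) k k' (phi : 'I_n -> 'I_n -> rat) :
  uniq [:: k, k' & unzip1 c] -> uniq (unzip2 c) ->
  \sum_(s : {perm 'I_n} | extends c s) phi (s k) (s k') =
  ((n - (size c).+2)`!)%:R *
    \sum_(l | l \notin unzip2 c) \sum_(l' | l' \notin l :: unzip2 c) phi l l'.
Proof.
rewrite /= inE negb_or -andbA => /and4P[kk' kc k'c u1] u2.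
rewrite (partition_big (fun s : {perm 'I_n} => s k) predT) //=.
rewrite (bigID (fun l => l \in unzip2 c)) /= big1 ?add0r.
  rewrite mulr_sumr; apply: eq_bigr => l lc.
  have := @cond_sum1 _ ((k, l) :: c) k' (phi l).
  rewrite /= inE negb_or eq_sym kk' k'c kc u1 lc u2 => /(_ isT isT isT) <-.
  rewrite (eq_bigl (extends ((k, l) :: c))); last by move=> s; rewrite /extends /= andbC.
  by apply: eq_bigr => s /andP[/eqP /= ->].
move=> l lc; apply: big1 => s /andP[cs /eqP sk].
have [x xc sx] := extends_val cs lc.
by move: kc; rewrite -sk in sx; rewrite -(perm_inj sx) xc.
Qed.

Lemma sum_not1 (T : finType) (phi : T -> rat) j :
  \sum_x phi x = 0 -> \sum_(x | x != j) phi x = - phi j.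
Proof. by rewrite (bigD1 j) //= => h; lra. Qed.

Lemma sum_split2 (T : finType) (phi : T -> rat) i i' : i != i' ->
  \sum_x phi x = phi i + phi i' + \sum_(x | x \notin [:: i; i']) phi x.
Proof.
move=> ii'; rewrite (bigD1 i) //= (bigD1 i') /=; last by rewrite eq_sym.
by rewrite addrA; congr (_ + _); apply: eq_bigl => x; rewrite !inE negb_or.
Qed.

Lemma sum_not2 (T : finType) (phi : T -> rat) i i' : i != i' ->
  \sum_x phi x = 0 -> \sum_(x | x \notin [:: i; i']) phi x = - phi i - phi i'.
Proof. by move=> /(sum_split2 phi) -> h; lra. Qed.

(** Row [i] contributes (n+1)! times [x i j]. As its entries sum to zero, any other row [k]
    contributes -n! times [x k j], and the zero column sum turns these into n! times [x i j]. *)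
Lemma marg_lin n (x : 'I_n.+2 -> 'I_n.+2 -> rat) i j :
  (forall i, \sum_j x i j = 0) -> (forall j, \sum_i x i j = 0) ->
  marg (lin x) i j = (n`!)%:R * (n.+2)%:R * x i j.
Proof.
move=> xr xc; rewrite /marg /lin exchange_big /= (bigD1 i) //=.
rewrite (eq_bigr (fun=> x i j)); last by move=> s /eqP ->.
rewrite sumr_const.
rewrite -[X in _ *+ X]/(#|[pred s : {perm 'I_n.+2} | s i == j]|) -cardsE.
rewrite -[[set _ | _]]/(one_coset i j) card_one_coset.
rewrite (eq_bigr (fun k => - (n`!)%:R * x k j)).
  by rewrite -mulr_sumr sum_not1 // -[_ *+ _]mulr_natl factS natrM -!natr1; ring.
move=> k ki; have := @cond_sum1 _ [:: (i, j)] k (x k).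
rewrite /= inE ki => /(_ isT isT isT).
rewrite (eq_bigl (fun s : {perm 'I_n.+2} => s i == j)); last first.
  by move=> s; rewrite /extends /= andbT.
move=> ->; rewrite subSS subn1 (eq_bigl (fun l => l != j)); last first.
  by move=> l; rewrite inE.
by rewrite sum_not1 //=; ring.
Qed.

Definition marg2 n (g : {perm 'I_n} -> rat) i j i' j' : rat :=
  \sum_(s : {perm 'I_n} | (s i == j) && (s i' == j')) g s.

Lemma sum_quad n (g : {perm 'I_n} -> rat) (t : 'I_n -> 'I_n -> 'I_n -> 'I_n -> rat) :
  \sum_s g s * (\sum_k \sum_k' t k (s k) k' (s k')) =
  \sum_k \sum_k' \sum_l \sum_l' t k l k' l' * marg2 g k l k' l'.
Proof.
under eq_bigr do rewrite mulr_sumr.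
rewrite exchange_big /=; apply: eq_bigr => k _.
under eq_bigr do rewrite mulr_sumr.
rewrite exchange_big /=; apply: eq_bigr => k' _.
rewrite (partition_big (fun s : {perm 'I_n} => s k) predT) //=.
apply: eq_bigr => l _.
rewrite (partition_big (fun s : {perm 'I_n} => s k') predT) //=.
apply: eq_bigr => l' _; rewrite /marg2 mulr_sumr.
by apply: eq_bigr => s /andP[/eqP -> /eqP ->]; rewrite mulrC.
Qed.

End ConditionalSums.

(** * Masses on pairs of prescribed values, for functions with no mass on 1-cosets *)

Section SecondLevel.
Local Open Scope ring_scope.
Variables (m : nat).
Local Notation n := m.+4.
Variable f : {perm 'I_n} -> rat.
Hypothesis f0 : forall i j, marg f i j = 0.

Local Notation h := (marg2 f).

Lemma marg2C i j i' j' : h i j i' j' = h i' j' i j.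
Proof. by apply: eq_bigl => s; rewrite andbC. Qed.

Lemma marg2_sum_val i j i' : \sum_j' h i j i' j' = 0.
Proof.
rewrite -[RHS](f0 i j) /marg [RHS](partition_big (fun s : {perm 'I_n} => s i') predT) //=.
Qed.

Lemma marg2_sum_pos i j j' : \sum_i' h i j i' j' = 0.
Proof.
rewrite -[RHS](f0 i j) /marg /marg2.
rewrite [RHS](partition_big (fun s : {perm 'I_n} => (s^-1)%g j') predT) //=.
apply: eq_bigr => i' _; apply: eq_bigl => s; congr (_ && _).
by rewrite -(inj_eq (@perm_inj _ s^-1%g)) permK eq_sym.
Qed.

Lemma marg2_pos i j j' : h i j i j' = 0.
Proof.
rewrite /marg2; have [<-|jj'] := eqVneq j j'.
  by rewrite -[RHS](f0 i j); apply: eq_bigl => s; rewrite andbb.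
apply: big1 => s /andP[/eqP -> /eqP e]; by rewrite e eqxx in jj'.
Qed.

Lemma marg2_val i i' j : h i j i' j = 0.
Proof.
rewrite /marg2; have [<-|jj'] := eqVneq i i'.
  by rewrite -[RHS](f0 i j); apply: eq_bigl => s; rewrite andbb.
apply: big1 => s /andP[/eqP e /eqP e'].
by rewrite -e' in e; rewrite (perm_inj e) eqxx in jj'.
Qed.

Let F (s : {perm 'I_n}) := \sum_k \sum_k' h k (s k) k' (s k').

(** The pairs [(k, k')] in [F] are sorted by how many entries lie in [{i, i'}]: two, one and none
    give the three terms. The zero sums of [h] turn each sum over positions or values outside into
    minus the terms inside. *)
Lemma marg2_quad i j i' j' : i != i' -> j != j' ->
  marg2 F i j i' j' = ((m.+2)`!)%:R * (2 * h i j i' j') +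
    ((m.+1)`!)%:R * (4 * h i j i' j') +
    (m`!)%:R * (2 * (h i j i' j' + h i j' i' j)).
Proof.
move=> ii' jj'; pose c := [:: (i, j); (i', j')].
pose W k k' := \sum_(s : {perm 'I_n} | extends c s) h k (s k) k' (s k').
have u1 : uniq (unzip1 c) by rewrite /= inE ii'.
have u2 : uniq (unzip2 c) by rewrite /= inE jj'.
have WC k k' : W k k' = W k' k by apply: eq_bigr => s _; rewrite marg2C.
have Wd k : W k k = 0 by apply: big1 => s _; rewrite marg2_pos.
have Wii' : W i i' = ((m.+2)`!)%:R * h i j i' j'.
  rewrite /W (eq_bigr (fun=> h i j i' j')).
    rewrite sumr_const -[LHS]mulr_natl; congr (_%:R * _).
    have := card_extends u1 u2; rewrite !subSS subn0 => <-.
    by apply: eq_card => s; rewrite inE.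
  by move=> s /and3P[/eqP /= -> /eqP /= ->].
have Wi k : k \notin [:: i; i'] -> W i k = - ((m.+1)`!)%:R * h i j k j'.
  move=> kc; have := @cond_sum1 _ c k (h i j k) kc u1 u2.
  rewrite [size _]/= !subSS subn0 (sum_not2 jj' (marg2_sum_val _ _ _)) marg2_val => e.
  rewrite /W; under eq_bigr => s /andP[/eqP /= -> _] do [].
  by rewrite e; ring.
have Wi' k : k \notin [:: i; i'] -> W i' k = - ((m.+1)`!)%:R * h i' j' k j.
  move=> kc; have := @cond_sum1 _ c k (h i' j' k) kc u1 u2.
  rewrite [size _]/= !subSS subn0 (sum_not2 jj' (marg2_sum_val _ _ _)) marg2_val => e.
  rewrite /W; under eq_bigr => s /and3P[_ /eqP /= -> _] do [].
  by rewrite e; ring.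
have Wo k k' : k \notin [:: i; i'] -> k' \notin [:: i; i'] ->
    W k k' = (m`!)%:R * (h k j k' j' + h k j' k' j).
  move=> kc k'c; have [->|kk'] := eqVneq k k'.
    by rewrite Wd !marg2_pos addr0 mulr0.
  have uk : uniq [:: k, k' & unzip1 c] by rewrite cons_uniq inE negb_or kk' kc cons_uniq k'c u1.
  have := @cond_sum2 _ c k k' (fun l l' => h k l k' l') uk u2.
  rewrite /W => ->; rewrite [size _]/= !subSS subn0; congr (_ * _).
  (* The inner sum omits [l' = l] besides [j] and [j']; this term may be restored since it is zero
     by [marg2_val]. *)
  rewrite (eq_bigr (fun l => - h k l k' j - h k l k' j')).
    rewrite sumrB sumrN.
    rewrite (sum_not2 (phi := fun l => h k l k' j) jj'); last first.
      by under eq_bigr do rewrite marg2C; exact: marg2_sum_val.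
    rewrite (sum_not2 (phi := fun l => h k l k' j') jj'); last first.
      by under eq_bigr do rewrite marg2C; exact: marg2_sum_val.
    by rewrite !marg2_val; ring.
  move=> l lc; rewrite -(sum_not2 jj' (marg2_sum_val k l k')).
  rewrite [RHS](bigD1 l) //= marg2_val add0r; apply: eq_bigl => l'.
  by rewrite [l' \in l :: _]inE negb_or andbC.
have -> : marg2 F i j i' j' = \sum_k \sum_k' W k k'.
  rewrite /marg2 /F exchange_big /=; apply: eq_bigr => k _.
  rewrite exchange_big /=; apply: eq_bigr => k' _.
  by apply: eq_bigl => s; rewrite /extends /= andbT.
have Wsum k : k \notin [:: i; i'] -> \sum_k' W k k' =
   - ((m.+1)`!)%:R * h i j k j' - ((m.+1)`!)%:R * h i' j' k j +
   (m`!)%:R * (- h i j' k j - h i' j' k j - h i j k j' - h i' j k j').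
  move=> kc; rewrite (sum_split2 _ ii') (WC k i) (WC k i') Wi // Wi' //.
  rewrite (eq_bigr (fun k' => (m`!)%:R * (h k j k' j' + h k j' k' j))); last first.
    by move=> k' k'c; exact: Wo.
  rewrite -mulr_sumr big_split /= !(sum_not2 ii') ?marg2_sum_pos //.
  by rewrite (marg2C k j i j') (marg2C k j i' j') (marg2C k j' i j) (marg2C k j' i' j); ring.
rewrite (sum_split2 _ ii') (eq_bigr _ Wsum) !(sum_split2 (W _) ii').
rewrite (eq_bigr _ Wi) (eq_bigr _ Wi').
rewrite !big_split /= !sumrN -!mulr_sumr !big_split /= !sumrN.
rewrite !(sum_not2 ii' (marg2_sum_pos _ _ _)) !Wd (WC i' i) Wii' !marg2_pos.
rewrite (marg2C i' j' i j) (marg2C i' j i j').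
by ring.
Qed.

Lemma kform2_marg2 : kform 2 f f = \sum_k \sum_k' \sum_l \sum_l' h k l k' l' ^+ 2.
Proof.
rewrite kform_rec; apply: eq_bigr => i _; rewrite [RHS]exchange_big /=.
apply: eq_bigr => j _; rewrite kform1 (bigD1_ord i) //=.
rewrite [X in _ = X + _]big1 ?add0r; last by move=> l _; rewrite marg2_pos expr0n.
apply: eq_bigr => k _; rewrite (bigD1_ord j) //= marg2_val expr0n add0r.
apply: eq_bigr => l _; rewrite -expr2; congr (_ ^+ 2).
rewrite /marg2 big_mkcondr /= sum_lift_perm /marg big_mkcond /=; apply: eq_bigr => s _.
by rewrite lift_perm_lift (inj_eq (@lift_inj _ _)).
Qed.

End SecondLevel.

(** * Norms of the second and third kernels on the orthogonal complement of [U] *)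

Section SpectralGap.
Local Open Scope ring_scope.

(** Lagrange's identity: twice the difference of the two sides is a sum of squares. *)
Lemma sum_CS (I : finType) (u v : I -> rat) :
  (\sum_i u i * v i) ^+ 2 <= (\sum_i u i ^+ 2) * (\sum_i v i ^+ 2).
Proof.
have : 0 <= \sum_i \sum_j (u i * v j - u j * v i) ^+ 2.
  by apply: sumr_ge0 => i _; apply: sumr_ge0 => j _; exact: sqr_ge0.
have -> : \sum_i \sum_j (u i * v j - u j * v i) ^+ 2 =
  2 * ((\sum_i u i ^+ 2) * (\sum_i v i ^+ 2)) - 2 * (\sum_i u i * v i) ^+ 2.
  rewrite (eq_bigr (fun i => u i ^+ 2 * (\sum_j v j ^+ 2) + v i ^+ 2 * (\sum_j u j ^+ 2)
     - 2 * (u i * v i) * \sum_j u j * v j)).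
    by rewrite sumrB big_split /= -!mulr_suml -mulr_sumr; ring.
  move=> i _; rewrite !mulr_sumr -sumrN -!big_split /=.
  by apply: eq_bigr => j _; ring.
by lra.
Qed.

Lemma ler_cancel_sq (x c : rat) : 0 <= x -> 0 <= c -> x ^+ 2 <= c * x -> x <= c.
Proof. by rewrite le_eqVlt => /orP[/eqP <- //|x0] _; rewrite expr2 ler_pM2r. Qed.

(* With [F s := \sum_k \sum_k' marg2 f k (s k) k' (s k')], the form is [<f, F>], while
   [marg2_quad] bounds [<F, F>] by [3 (m+2)! <f, F>]; conclude by Cauchy-Schwarz. *)
Lemma kform2_le m (f : {perm 'I_m.+4} -> rat) : (3 <= m)%N ->
  (forall i j, marg f i j = 0) ->
  kform 2 f f <= 3 * ((m.+2)`!)%:R * \sum_s f s ^+ 2.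
Proof.
move=> m3 f0; set H := kform 2 f f.
pose F (s : {perm 'I_m.+4}) := \sum_k \sum_k' marg2 f k (s k) k' (s k').
have H0 : 0 <= H := kform_ge0 2 f.
have HE : H = \sum_k \sum_k' \sum_l \sum_l' marg2 f k l k' l' ^+ 2 by exact: kform2_marg2.
have fF : \sum_s f s * F s = H.
  rewrite sum_quad HE.
  by do 4![apply: eq_bigr => ? _]; rewrite expr2.
have FF : \sum_s F s ^+ 2 <= 3 * ((m.+2)`!)%:R * H.
  under eq_bigr do rewrite expr2 {2}/F.
  rewrite sum_quad.
  pose c2 : rat := ((m.+2)`!)%:R; pose c1 : rat := ((m.+1)`!)%:R; pose c0 : rat := (m`!)%:R.
  have c00 : 0 <= c0 by exact: ler0n.
  have c10 : 0 <= c1 by exact: ler0n.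
  have c20 : 0 <= c2 by exact: ler0n.
  (* Divided by m! this reads 4 (m+2) <= (m+2) (m+1), which is where [3 <= m] enters. *)
  have cc : 4 * c1 + 4 * c0 <= c2.
    by rewrite /c2 /c1 /c0 -!natrM -natrD ler_nat !factS; nia.
  apply: (@le_trans _ _ (\sum_k \sum_k' \sum_l \sum_l'
    ((2 * c2 + 4 * c1 + 3 * c0) * marg2 f k l k' l' ^+ 2 + c0 * marg2 f k l' k' l ^+ 2))).
    apply: ler_sum => k _; apply: ler_sum => k' _.
    apply: ler_sum => l _; apply: ler_sum => l' _.
    have q1 := sqr_ge0 (marg2 f k l k' l'); have q2 := sqr_ge0 (marg2 f k l' k' l).
    have [e|kk'] := eqVneq k k'.
      by rewrite e !(marg2_pos f0) mul0r !expr0n /= !mulr0 addr0.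
    have [e|ll'] := eqVneq l l'.
      by rewrite e !(marg2_val f0) mul0r !expr0n /= !mulr0 addr0.
    rewrite marg2_quad // -/c0 -/c1 -/c2.
    have := sqr_ge0 (marg2 f k l k' l' - marg2 f k l' k' l).
    set u := marg2 f k l k' l'; set v := marg2 f k l' k' l => uv.
    have := mulr_ge0 c00 uv; lra.
  (* Summed over both [l] and [l'], the squares with the two values exchanged also add up to [H]. *)
  rewrite (_ : \sum_k _ = (2 * c2 + 4 * c1 + 4 * c0) * H); last first.
    rewrite HE mulr_sumr; apply: eq_bigr => k _; rewrite mulr_sumr; apply: eq_bigr => k' _.
    under eq_bigr do rewrite big_split.
    rewrite big_split /= [X in _ + X]exchange_big /= -big_split mulr_sumr /=.
    apply: eq_bigr => l _; rewrite -big_split mulr_sumr /=.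
    by apply: eq_bigr => l' _; ring.
  by apply: ler_wpM2r => //; rewrite -/c2; lra.
have S0 : 0 <= \sum_s f s ^+ 2 by apply: sumr_ge0 => s _; exact: sqr_ge0.
have := sum_CS f F; rewrite fF => CS.
apply: ler_cancel_sq => //; first by rewrite !mulr_ge0 ?ler0n.
apply: le_trans CS _; rewrite [leRHS](_ : _ =
   (\sum_s f s ^+ 2) * (3 * ((m.+2)`!)%:R * H)); last by ring.
exact: ler_wpM2l.
Qed.

Lemma marg_cst n (c : rat) (i j : 'I_n.+1) : marg (fun=> c) i j = (n`!)%:R * c.
Proof. by rewrite -sum_restr sumr_const card_Sn -[LHS]mulr_natl. Qed.

Lemma marg_centered n (f : {perm 'I_n.+2} -> rat) :
  let x i j := marg f i j - (\sum_s f s) / (n.+2)%:R in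
  (forall i, \sum_j x i j = 0) /\ (forall j, \sum_i x i j = 0).
Proof.
have nz : (n.+2)%:R != 0 :> rat by rewrite pnatr_eq0.
move=> x; split=> i; rewrite sumrB ?sum_marg_r ?sum_marg_l sumr_const card_ord.
  by rewrite -[_ *+ _]mulr_natr divfK // subrr.
by rewrite -[_ *+ _]mulr_natr divfK // subrr.
Qed.

(** Orthogonal projection to [U]: a function with zero [marg] is orthogonal to every 1-coset. *)
Lemma lin_decomposition n (f : {perm 'I_n.+2} -> rat) :
  exists z, forall i j, marg (fun s => f s - lin z s) i j = 0.
Proof.
pose S := \sum_s f s; pose x i j := marg f i j - S / (n.+2)%:R.
have [xr xc] := marg_centered f.
have nz : (n.+2)%:R != 0 :> rat by rewrite pnatr_eq0.
have nz1 : (n.+1)%:R != 0 :> rat by rewrite pnatr_eq0.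
have fz : (n`!)%:R != 0 :> rat by rewrite pnatr_eq0 -lt0n fact_gt0.
(* The first term inverts the factor in [marg_lin]; the second, constant over the table, makes [lin]
   produce the mean of [f]. *)
exists (fun i j => x i j * ((n`!)%:R * (n.+2)%:R)^-1 + S / ((n.+2)%:R * (n.+2)`!%:R)).
move=> i j; rewrite margB.
rewrite (@marg_eq _ (lin _) (fun s => lin x s * ((n`!)%:R * (n.+2)%:R)^-1 - - (S / (n.+2)`!%:R))).
  rewrite margB marg_cst.
  have -> : marg (fun s => lin x s * ((n`!)%:R * (n.+2)%:R)^-1) i j = x i j.
    by rewrite {1}/marg -mulr_suml -/(marg _ i j) marg_lin // mulrAC divff ?mul1r ?mulf_neq0.
  rewrite /x !factS !natrM.
  move: (n.+2)%:R (n.+1)%:R (n`!)%:R nz nz1 fz => u v w uz vz wz; field.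
  by rewrite uz vz wz.
move=> s; rewrite /lin big_split /= -mulr_suml sumr_const card_ord opprK.
by congr (_ + _); rewrite -[_ *+ _]mulr_natr invfM mulrA mulrAC divfK.
Qed.

Section Orthogonal.
Variables (n : nat) (f : {perm 'I_n.+2} -> rat).
Hypothesis f0 : forall i j, marg f i j = 0.

Lemma sum_orth : \sum_s f s = 0.
Proof. by rewrite -(sum_marg_r f ord0) big1. Qed.

Lemma sum_lin_orth z : \sum_s f s * lin z s = 0.
Proof. by rewrite sum_lin_marg big1 // => i _; rewrite big1 // => j _; rewrite f0 mulr0. Qed.

Lemma kform_lin_orth k z : (k <= n.+1)%N -> kform k f (lin z) = 0.
Proof. by move=> kn; rewrite kform_lin // sum_orth sum_lin_orth !mulr0 addr0. Qed.

Lemma kform1_orth : kform 1 f f = 0.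
Proof. by rewrite kform1 big1 // => i _; rewrite big1 // => j _; rewrite f0 mulr0. Qed.

End Orthogonal.

(** The cross terms vanish because the kernel maps [U] into [U]. *)
Lemma kform_split k n (f g : {perm 'I_n.+2} -> rat) z z' : (k <= n.+1)%N ->
  (forall i j, marg (fun s => f s - lin z s) i j = 0) ->
  (forall i j, marg (fun s => g s - lin z' s) i j = 0) ->
  kform k f g = kform k (lin z) (lin z') +
     kform k (fun s => f s - lin z s) (fun s => g s - lin z' s).
Proof.
move=> kn f0 g0.
have e1 : f =1 (fun s => (f s - lin z s) + 1 * lin z s) by move=> s; ring.
have e2 : g =1 (fun s => (g s - lin z' s) + 1 * lin z' s) by move=> s; ring.
rewrite (eq_kform _ e1 e2) kformDl !kformDr.
rewrite (kform_lin_orth f0) // (kformC k (lin z)) (kform_lin_orth g0) //.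
by ring.
Qed.

Lemma sum_lin n (z : 'I_n.+1 -> 'I_n.+1 -> rat) :
  \sum_s lin z s = (n`!)%:R * \sum_i \sum_j z i j.
Proof.
have := sum_lin_marg (fun=> 1) z; under eq_bigr do rewrite mul1r.
move=> ->; rewrite mulr_sumr; apply: eq_bigr => i _; rewrite mulr_sumr.
by apply: eq_bigr => j _; rewrite marg_cst; ring.
Qed.

Lemma sum_orth_sq_le n (f : {perm 'I_n.+2} -> rat) z :
  (forall i j, marg (fun s => f s - lin z s) i j = 0) ->
  \sum_s (f s - lin z s) ^+ 2 <= \sum_s f s ^+ 2.
Proof.
move=> f0; have := sum_lin_orth f0 z => e.
have -> : \sum_s f s ^+ 2 = \sum_s (f s - lin z s) ^+ 2 + \sum_s lin z s ^+ 2
    + 2 * \sum_s (f s - lin z s) * lin z s.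
  by rewrite mulr_sumr -!big_split /=; apply: eq_bigr => s _; ring.
by rewrite e mulr0 addr0 lerDl sumr_ge0 // => s _; exact: sqr_ge0.
Qed.

(** A form of [kform2_le] without orthogonality, needed for restrictions to cosets. On [U] the two
    sides have the same term in the square sum of [lin z], and the coefficient of the squared total
    of [z] is larger on the right. *)
Lemma kform2_le_kform1 m (g : {perm 'I_m.+4} -> rat) : (3 <= m)%N ->
  kform 2 g g <= 2 * kform 1 g g + 3 * ((m.+2)`!)%:R * \sum_s g s ^+ 2.
Proof.
move=> m3; have [z g0] := lin_decomposition g.
rewrite !(kform_split _ g0 g0) ?(kform1_orth g0) //.
have le2 := kform2_le m3 g0.
have le1 := sum_orth_sq_le g0.
have c0 : 0 <= 3 * ((m.+2)`!)%:R :> rat by rewrite mulr_ge0.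
have {le1}le1 := ler_wpM2l c0 le1.
suff : kform 2 (lin z) (lin z) <= 2 * kform 1 (lin z) (lin z) by lra.
rewrite !kform_lin // sum_lin; set Z := \sum_i \sum_j z i j.
have Z0 : 0 <= ((m.+2)`!)%:R * (((m.+3)`!)%:R * Z ^+ 2) :> rat.
  by do 2![apply: mulr_ge0; first exact: ler0n]; exact: sqr_ge0.
have Z1 : 0 <= (m.+3)%:R * (((m.+2)`!)%:R * (((m.+3)`!)%:R * Z ^+ 2)) :> rat.
  by apply: mulr_ge0; first exact: ler0n.
by lra.
Qed.

(** [kform2_le_kform1] is applied to every restriction [restr f i j]. The forms of order 1 add up to
    [kform 2 f f], and each square [f s ^+ 2] is counted once for every position [i]. *)
Lemma kform3_le m (f : {perm 'I_m.+4.+1} -> rat) : (3 <= m)%N ->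
  (forall i j, marg f i j = 0) ->
  kform 3 f f <= 12 * ((m.+3)`!)%:R * \sum_s f s ^+ 2.
Proof.
move=> m3 f0; rewrite kform_rec.
have le2 := kform2_le (leqW m3) f0.
have S0 : 0 <= \sum_s f s ^+ 2 by apply: sumr_ge0 => s _; exact: sqr_ge0.
apply: (@le_trans _ _ (2 * kform 2 f f + 3 * ((m.+2)`!)%:R * ((m.+4.+1)%:R * \sum_s f s ^+ 2))).
  rewrite (kform_rec 1).
  have -> : (m.+4.+1)%:R * \sum_s f s ^+ 2 =
      \sum_i \sum_j \sum_s restr f i j s ^+ 2 :> rat.
    transitivity (\sum_(i < m.+4.+1) \sum_s f s ^+ 2).
      by rewrite sumr_const card_ord [LHS]mulr_natl.
    apply: eq_bigr => i _; rewrite -(sum_marg_r (fun s => f s ^+ 2) i).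
    by apply: eq_bigr => j _; rewrite -sum_restr.
  rewrite !mulr_sumr -big_split /=; apply: ler_sum => i _.
  rewrite !mulr_sumr -big_split /=; apply: ler_sum => j _.
  exact: kform2_le_kform1.
have : ((m.+2)`!)%:R * ((m.+4.+1)%:R * \sum_s f s ^+ 2) <=
    2 * ((m.+3)`!)%:R * \sum_s f s ^+ 2.
  rewrite mulrA; apply: ler_wpM2r => //.
  by rewrite -!natrM ler_nat (factS m.+2); nia.
move: le2; lra.
Qed.

(* This combination vanishes on constants and on all [lin z], so only the parts of
   [f] and [g] orthogonal to the 1-cosets contribute. *)
Definition third_diff n (f g : {perm 'I_n} -> rat) : rat :=
  kform 0 f g - 3 * kform 1 f g + 3 * kform 2 f g - kform 3 f g.

Lemma third_diff_le m (f g : {perm 'I_m.+4.+1} -> rat) : (3 <= m)%N ->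
  third_diff f g ^+ 2 <=
  450 * ((m.+3)`!)%:R ^+ 2 * ((\sum_s f s ^+ 2) * \sum_s g s ^+ 2).
Proof.
move=> m3; have [z f0] := lin_decomposition f; have [z' g0] := lin_decomposition g.
have split k (kn : (k <= m.+4)%N) := kform_split kn f0 g0.
rewrite /third_diff (split 0%N isT) (split 1%N isT) (split 2%N isT) (split 3%N isT).
set fp := fun s => f s - lin z s; set gp := fun s => g s - lin z' s.
have -> : kform 0 fp gp = 0 by rewrite kform0 (sum_orth f0) mul0r.
have -> : kform 1 fp gp = 0.
  by rewrite kform1 big1 // => i _; rewrite big1 // => j _; rewrite f0 mul0r.
have linE k (kn : (k <= m.+4)%N) := kform_lin (lin z) z' kn.
rewrite (linE 0%N isT) (linE 1%N isT) (linE 2%N isT) (linE 3%N isT).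
set E := (X in X ^+ 2 <= _).
(* The contributions of [lin z] and [lin z'] cancel, their coefficients being affine in the order of
   the form. *)
have {E}-> : E = 3 * kform 2 fp gp - kform 3 fp gp by rewrite /E -!natr1; ring.
have pos k (u : {perm 'I_m.+4.+1} -> rat) := kform_ge0 k u.
have sq (u : {perm 'I_m.+4.+1} -> rat) : 0 <= \sum_s u s ^+ 2.
  by apply: sumr_ge0 => s _; exact: sqr_ge0.
set T : rat := ((m.+3)`!)%:R; have T0 : 0 <= T by exact: ler0n.
set a := \sum_s f s ^+ 2; set b := \sum_s g s ^+ 2.
have a0 : 0 <= a := sq f; have b0 : 0 <= b := sq g.
have bnd k c (c0 : 0 <= c) (hyp : forall u : {perm 'I_m.+4.+1} -> rat,
   (forall i j, marg u i j = 0) -> kform k u u <= c * T * \sum_s u s ^+ 2) :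
   kform k fp gp ^+ 2 <= c ^+ 2 * T ^+ 2 * (a * b).
  apply: le_trans (kform_CS _ _ _) _.
  have -> : c ^+ 2 * T ^+ 2 * (a * b) = (c * T * a) * (c * T * b) by ring.
  have cT : 0 <= c * T by exact: mulr_ge0.
  apply: ler_pM => //.
    by apply: le_trans (hyp _ f0) _; apply: ler_wpM2l (sum_orth_sq_le f0).
  by apply: le_trans (hyp _ g0) _; apply: ler_wpM2l (sum_orth_sq_le g0).
have B2 := bnd 2 3 isT (fun u u0 => kform2_le (leqW m3) u0).
have B3 := bnd 3 12 isT (fun u u0 => kform3_le m3 u0).
(* With (u - v)^2 <= 2 u^2 + 2 v^2 the constant is 2 * 9 * 3^2 + 2 * 12^2 = 450. *)
have := sqr_ge0 (3 * kform 2 fp gp + kform 3 fp gp).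
by lra.
Qed.

End SpectralGap.

(** * Fourth moments and the level-one weight of a family *)

Section LevelOne.
Local Open Scope ring_scope.

Definition normsq n (y : 'I_n -> 'I_n -> rat) : rat := \sum_i \sum_j y i j ^+ 2.

Lemma normsq_ge0 n (y : 'I_n -> 'I_n -> rat) : 0 <= normsq y.
Proof. by apply: sumr_ge0 => i _; apply: sumr_ge0 => j _; exact: sqr_ge0. Qed.

Lemma lin_tperm n (y : 'I_n -> 'I_n -> rat) i j (s : {perm 'I_n}) :
  lin y s - lin y (tperm i j * s)%g = y i (s i) + y j (s j) - y i (s j) - y j (s i).
Proof.
have [<-|ij] := eqVneq i j; first by rewrite tperm1 mul1g; ring.
rewrite /lin !(sum_split2 _ ij) !permM tpermL tpermR.
rewrite (eq_bigr (fun x => y x ((tperm i j * s)%g x))); first by ring.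
by move=> x; rewrite !inE negb_or => /andP[xi xj]; rewrite permM tpermD // eq_sym.
Qed.

(** [lin y] is an eigenfunction of averaging over transpositions: by the zero row sums the mixed
    terms of [lin_tperm] cancel. *)
Lemma sum_tperm_diff n (y : 'I_n -> 'I_n -> rat) (s : {perm 'I_n}) :
  (forall i, \sum_j y i j = 0) ->
  \sum_i \sum_j (lin y s - lin y (tperm i j * s)%g) = 2 * n%:R * lin y s.
Proof.
move=> yr.
have rows i : \sum_j y i (s j) = 0.
  by rewrite -[RHS](yr i) [RHS](reindex_inj (@perm_inj _ s)).
transitivity (\sum_i (n%:R * y i (s i) + lin y s - \sum_j y j (s i))).
  apply: eq_bigr => i _; under eq_bigr => j _ do rewrite lin_tperm.
  rewrite !big_split /= !sumrN rows subr0 sumr_const card_ord.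
  by rewrite -[_ *+ n]mulr_natl.
rewrite sumrB exchange_big /= [X in _ - X]big1 ?subr0; last by move=> j _; exact: rows.
rewrite big_split /= sumr_const card_ord -mulr_sumr -/(lin y s).
by rewrite -[_ *+ n]mulr_natl; ring.
Qed.

(* Exchangeable pairs: multiplying by a uniform transposition maps [lin y] to a
   multiple of itself on average, so that its fourth moment is controlled by the
   second moment of the increments. *)
Lemma fourth_moment_pre n (y : 'I_n -> 'I_n -> rat) :
  (forall i, \sum_j y i j = 0) ->
  n%:R * \sum_s lin y s ^+ 4 <=
  6 * \sum_s lin y s ^+ 2 * (n%:R * lin (fun i j => y i j ^+ 2) s + normsq y).
Proof.
move=> yr; pose l := lin y; pose l' i j s := lin y (tperm i j * s)%g.
have invol i j (G : {perm 'I_n} -> rat) : \sum_s G (tperm i j * s)%g = \sum_s G s.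
  by rewrite [RHS](reindex_inj (mulgI (tperm i j))).
have l'K i j s : l' i j (tperm i j * s)%g = l s by rewrite /l' mulgA tperm2 mul1g.
(* Symmetrised by the involution, this is (u - v)(u^3 - v^3) <= 3/2 (u - v)^2 (u^2 + v^2), with
   difference (u - v)^4 / 2. *)
have key i j : \sum_s (l s - l' i j s) * l s ^+ 3 <=
    3 / 2 * \sum_s (l s - l' i j s) ^+ 2 * l s ^+ 2.
  have e1 := invol i j (fun s => (l s - l' i j s) * l s ^+ 3).
  have e2 := invol i j (fun s => (l s - l' i j s) ^+ 2 * l s ^+ 2).
  have : \sum_s (l s - l' i j s) * l s ^+ 3 +
         \sum_s (l (tperm i j * s)%g - l' i j (tperm i j * s)%g) * l (tperm i j * s)%g ^+ 3 <=
    3 / 2 * (\sum_s (l s - l' i j s) ^+ 2 * l s ^+ 2 +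
     \sum_s (l (tperm i j * s)%g - l' i j (tperm i j * s)%g) ^+ 2 * l (tperm i j * s)%g ^+ 2).
    rewrite -!big_split mulr_sumr /=; apply: ler_sum => s _.
    rewrite l'K -/(l' i j s) -[l (_ * _)%g]/(l' i j s).
    set u := l s; set v := l' i j s.
    have := mulr_ge0 (sqr_ge0 (u - v)) (sqr_ge0 (u - v)); lra.
  by rewrite e1 e2; lra.
have sumkey : 2 * n%:R * \sum_s l s ^+ 4 <=
    3 / 2 * \sum_s l s ^+ 2 * \sum_i \sum_j (l s - l' i j s) ^+ 2.
  have -> : 2 * n%:R * \sum_s l s ^+ 4 =
      \sum_i \sum_j \sum_s (l s - l' i j s) * l s ^+ 3.
    under [RHS]eq_bigr do rewrite exchange_big.
    rewrite [RHS]exchange_big mulr_sumr /=; apply: eq_bigr => s _.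
    under [RHS]eq_bigr do rewrite -mulr_suml.
    by rewrite -mulr_suml sum_tperm_diff // -/(l s); ring.
  have -> : \sum_s l s ^+ 2 * \sum_i \sum_j (l s - l' i j s) ^+ 2 =
      \sum_i \sum_j \sum_s (l s - l' i j s) ^+ 2 * l s ^+ 2.
    under [RHS]eq_bigr do rewrite exchange_big.
    rewrite [RHS]exchange_big /=; apply: eq_bigr => s _.
    under [RHS]eq_bigr do rewrite -mulr_suml.
    by rewrite -mulr_suml mulrC.
  rewrite mulr_sumr; apply: ler_sum => i _; rewrite mulr_sumr; apply: ler_sum => j _.
  exact: key.
have incr s : \sum_i \sum_j (l s - l' i j s) ^+ 2 <=
    8 * (n%:R * lin (fun i j => y i j ^+ 2) s + normsq y).
  have cols : \sum_i \sum_j y i (s j) ^+ 2 = normsq y.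
    by apply: eq_bigr => i _; rewrite [RHS](reindex_inj (@perm_inj _ s)).
  have diag : \sum_(i < n) \sum_(j < n) y i (s i) ^+ 2 = n%:R * lin (fun i j => y i j ^+ 2) s.
    under eq_bigr do rewrite sumr_const card_ord -[_ *+ n]mulr_natl.
    by rewrite -mulr_sumr.
  have -> : 8 * (n%:R * lin (fun i j => y i j ^+ 2) s + normsq y) =
    \sum_i \sum_j 4 * (y i (s i) ^+ 2 + y j (s j) ^+ 2 + y i (s j) ^+ 2 + y j (s i) ^+ 2).
    under [RHS]eq_bigr => i _ do rewrite -mulr_sumr !big_split /=.
    rewrite -mulr_sumr !big_split /= diag cols.
    have -> : \sum_(i < n) \sum_(j < n) y j (s j) ^+ 2 = n%:R * lin (fun i j => y i j ^+ 2) s.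
      by rewrite exchange_big diag.
    have -> : \sum_i \sum_j y j (s i) ^+ 2 = normsq y by rewrite exchange_big.
    by ring.
  apply: ler_sum => i _; apply: ler_sum => j _; rewrite lin_tperm.
  set p := y i (s i); set q := y j (s j); set r := y i (s j); set t := y j (s i).
  have := sqr_ge0 (p - q); have := sqr_ge0 (r - t).
  by have := sqr_ge0 (p + r); have := sqr_ge0 (p + t);
     have := sqr_ge0 (q + r); have := sqr_ge0 (q + t); lra.
have : \sum_s l s ^+ 2 * \sum_i \sum_j (l s - l' i j s) ^+ 2 <=
   8 * \sum_s l s ^+ 2 * (n%:R * lin (fun i j => y i j ^+ 2) s + normsq y).
  rewrite mulr_sumr; apply: ler_sum => s _; rewrite mulrCA.
  by apply: ler_wpM2l (incr s); exact: sqr_ge0.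
by move: sumkey; rewrite /l; lra.
Qed.

(** The sum of squares is the pairing of [w] with the masses of [lin w]. In each mass, row [i] gives
    at most (n+1)! [mu] and the other rows at most n! times the total of [w]. *)
Lemma sum_lin_sq_le n (w : 'I_n.+2 -> 'I_n.+2 -> rat) mu :
  (forall i j, 0 <= w i j) -> (forall i j, w i j <= mu) ->
  \sum_s lin w s ^+ 2 <=
  (n.+1`!)%:R * (mu * \sum_i \sum_j w i j) + (n`!)%:R * (\sum_i \sum_j w i j) ^+ 2.
Proof.
move=> w0 wmu; set W := \sum_i \sum_j w i j.
under eq_bigr do rewrite expr2.
rewrite sum_lin_marg.
have le i j : marg (lin w) i j <= (n.+1`!)%:R * mu + (n`!)%:R * W.
  rewrite /marg /lin exchange_big /= (bigD1 i) //=.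
  apply: lerD.
    rewrite (eq_bigr (fun=> w i j)); last by move=> s /eqP ->.
    rewrite -/(marg (fun=> w i j) i j) marg_cst.
    by apply: ler_wpM2l => //; exact: ler0n.
  rewrite /W mulr_sumr [leRHS](bigD1 i) //= -[leLHS]add0r; apply: lerD.
    by apply: mulr_ge0; [exact: ler0n|exact: sumr_ge0].
  apply: ler_sum => k ki; have := @cond_sum1 _ [:: (i, j)] k (w k).
  rewrite /= inE ki => /(_ isT isT isT).
  rewrite (eq_bigl (fun s : {perm 'I_n.+2} => s i == j)); last first.
    by move=> s; rewrite /extends /= andbT.
  move=> ->; rewrite subSS subn1; apply: ler_wpM2l; first exact: ler0n.
  rewrite [leRHS](bigID (fun l => l \notin [:: j])) /= lerDl.
  exact: sumr_ge0.
have -> : (n.+1`!)%:R * (mu * W) + (n`!)%:R * W ^+ 2 =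
   \sum_i \sum_j w i j * ((n.+1`!)%:R * mu + (n`!)%:R * W).
  by under eq_bigr do rewrite -mulr_suml; rewrite -mulr_suml -/W; ring.
by apply: ler_sum => i _; apply: ler_sum => j _; apply: ler_wpM2l.
Qed.

(** A self-bounding argument: Cauchy-Schwarz in [fourth_moment_pre] bounds [Q ^+ 2] by [Q] times 36
    times the second moment of [V + Y / N]. One factor [Q] cancels and [sum_lin_sq_le] applies to
    the squared table. *)
Lemma fourth_moment n (y : 'I_n.+2 -> 'I_n.+2 -> rat) mu :
  (forall i, \sum_j y i j = 0) -> (forall i j, y i j ^+ 2 <= mu) ->
  \sum_s lin y s ^+ 4 <=
  72 * (n.+1`!)%:R * (mu * normsq y) + 144 * (n`!)%:R * normsq y ^+ 2.
Proof.
move=> yr ymu; set Y := normsq y; set Q := \sum_s _.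
set N : rat := (n.+2)%:R; have N0 : 0 < N by rewrite ltr0n.
have Nz : N != 0 by rewrite gt_eqF.
pose V := lin (fun i j => y i j ^+ 2).
have pre : Q <= 6 * \sum_s lin y s ^+ 2 * (V s + Y / N).
  have := fourth_moment_pre yr; rewrite -/N -/Q -/Y => h.
  rewrite -(ler_pM2l N0); apply: le_trans h _.
  rewrite [leRHS]mulrCA; apply: ler_wpM2l; first exact: ler0n.
  rewrite mulr_sumr.
  by rewrite le_eqVlt; apply/orP; left; apply/eqP/eq_bigr => s _;
     rewrite [RHS]mulrCA; congr (_ * _); rewrite mulrDr mulrCA divff ?mulr1.
have Q0 : 0 <= Q.
  by apply: sumr_ge0 => s _; rewrite (exprM _ 2 2) sqr_ge0.
have U0 : 0 <= \sum_s (V s + Y / N) ^+ 2 by apply: sumr_ge0 => s _; exact: sqr_ge0.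
have QU : Q <= 36 * \sum_s (V s + Y / N) ^+ 2.
  apply: ler_cancel_sq; [exact: Q0|by apply: mulr_ge0; first exact: ler0n|].
  have CS := sum_CS (fun s => lin y s ^+ 2) (fun s => V s + Y / N).
  rewrite [X in _ <= X * _](eq_bigr (fun s => lin y s ^+ 4)) -/Q in CS; last first.
    by move=> s _; rewrite -exprM.
  have B0 : 0 <= 6 * \sum_s lin y s ^+ 2 * (V s + Y / N) by apply: le_trans Q0 pre.
  have := ler_pM Q0 Q0 pre pre.
  rewrite -!expr2 exprMn; move: CS; lra.
apply: le_trans QU _.
have V2 : \sum_s V s ^+ 2 <= (n.+1`!)%:R * (mu * Y) + (n`!)%:R * Y ^+ 2.
  by apply: sum_lin_sq_le => // i j; exact: sqr_ge0.
have split : \sum_s (V s + Y / N) ^+ 2 <=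
   2 * \sum_s V s ^+ 2 + 2 * (n.+2`!)%:R * (Y / N) ^+ 2.
  have -> : 2 * (n.+2`!)%:R * (Y / N) ^+ 2 =
       \sum_(s : {perm 'I_n.+2}) 2 * (Y / N) ^+ 2.
    by rewrite sumr_const card_Sn -[RHS]mulr_natl; ring.
  rewrite mulr_sumr -big_split /=; apply: ler_sum => s _.
  by move: (V s) (Y / N) => u v; have := sqr_ge0 (u - v); lra.
have last : (n.+2`!)%:R * (Y / N) ^+ 2 <= (n`!)%:R * Y ^+ 2.
  have -> : (n.+2`!)%:R * (Y / N) ^+ 2 = (n`!)%:R * Y ^+ 2 * ((n.+1)%:R / N).
    rewrite !factS !natrM -/N.
    have gen (u v w : rat) : u != 0 -> u * (v * w) * (Y / u) ^+ 2 = w * Y ^+ 2 * (v / u).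
      by move=> uz; field.
    exact: gen.
  rewrite -[leRHS]mulr1; apply: ler_wpM2l.
    by apply: mulr_ge0; [exact: ler0n|exact: sqr_ge0].
  by rewrite ler_pdivrMr // mul1r ler_nat.
move: V2 split last; rewrite -[2 * _ * _ ^+ 2]mulrA.
by move: (_ * (Y / N) ^+ 2) => u; lra.
Qed.

(** Level-one coefficients: up to a factor depending on [n], [normsq (dev f)] is the squared norm of
    the projection of [f] to the part of [U] orthogonal to constants. *)
Definition dev n (f : {perm 'I_n} -> rat) i j : rat :=
  marg f i j - (\sum_s f s) / n%:R.

Lemma sum_dev_marg n (f g : {perm 'I_n.+2} -> rat) :
  \sum_i \sum_j dev f i j * marg g i j = \sum_i \sum_j dev f i j * dev g i j.
Proof.
apply: eq_bigr => i _.
have -> : \sum_j dev f i j * marg g i j =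
   \sum_j dev f i j * dev g i j + (\sum_j dev f i j) * ((\sum_s g s) / (n.+2)%:R).
  rewrite mulr_suml -big_split /=; apply: eq_bigr => j _.
  by rewrite [dev g i j]/dev; ring.
by have [-> _] := marg_centered f; rewrite mul0r addr0.
Qed.

Lemma kform1_dev n (f g : {perm 'I_n.+2} -> rat) :
  kform 1 f g = \sum_i \sum_j dev f i j * dev g i j + (\sum_s f s) * \sum_s g s.
Proof.
have nz : (n.+2)%:R != 0 :> rat by rewrite pnatr_eq0.
rewrite kform1 -sum_dev_marg.
have -> : (\sum_s f s) * (\sum_s g s) =
   \sum_(i < n.+2) \sum_j (\sum_s f s) / (n.+2)%:R * marg g i j.
  under [RHS]eq_bigr do rewrite -mulr_sumr sum_marg_r.
  by rewrite sumr_const card_ord -[RHS]mulr_natr mulrAC divfK.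
rewrite -big_split /=; apply: eq_bigr => i _; rewrite -big_split /=.
by apply: eq_bigr => j _; rewrite /dev; ring.
Qed.

Section Boolean.
Variables (n : nat) (f : {perm 'I_n.+2} -> rat).
Hypothesis fb : forall s, f s ^+ 2 = f s.
Let b := \sum_s f s.
Let Y := normsq (dev f).

Lemma boolean_sum_ge0 : 0 <= b.
Proof. by apply: sumr_ge0 => s _; rewrite -fb sqr_ge0. Qed.

Lemma sum_lin_dev : \sum_s f s * lin (dev f) s = Y.
Proof.
rewrite sum_lin_marg sum_dev_marg.
by apply: eq_bigr => i _; apply: eq_bigr => j _; rewrite expr2.
Qed.

Lemma sum_boolean_sq : \sum_s f s ^+ 2 = b.
Proof. by apply: eq_bigr. Qed.

(** Cauchy-Schwarz for [f] against [lin (dev f)]: the inner product is [Y], and the squared norm of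
    [lin (dev f)] is a multiple of [Y] by [marg_lin]; one [Y] cancels. *)
Lemma level_one_bessel : Y <= b * ((n.+2)%:R * (n`!)%:R).
Proof.
have [dr dc] := marg_centered f.
have CS := sum_CS f (lin (dev f)); rewrite sum_lin_dev sum_boolean_sq in CS.
have e : \sum_s lin (dev f) s ^+ 2 = (n.+2)%:R * (n`!)%:R * Y.
  under eq_bigr do rewrite expr2.
  rewrite sum_lin_marg mulr_sumr; apply: eq_bigr => i _; rewrite mulr_sumr.
  by apply: eq_bigr => j _; rewrite marg_lin //; ring.
apply: ler_cancel_sq; first exact: normsq_ge0.
  by rewrite !mulr_ge0 ?ler0n ?boolean_sum_ge0.
by apply: le_trans CS _; rewrite e mulrA.
Qed.

(** Since [f] is 0-1 valued, Cauchy-Schwarz on its support applies twice, from [l] to [l ^+ 2] and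
    then to [l ^+ 4]; [fourth_moment] bounds the last sum. If all deviations are small, a small
    family thus has little level-one weight. *)
Lemma level_one_fourth mu : (forall i j, dev f i j ^+ 2 <= mu) ->
  Y ^+ 3 <= b ^+ 3 * (72 * (n.+1`!)%:R * mu + 144 * (n`!)%:R * Y).
Proof.
move=> dmu; have [dr dc] := marg_centered f.
have b0 := boolean_sum_ge0; have Y0 : 0 <= Y := normsq_ge0 _.
have mu0 : 0 <= mu by apply: le_trans (dmu ord0 ord0); exact: sqr_ge0.
have Q := fourth_moment dr dmu.
set l := lin (dev f); pose Z := \sum_s f s * l s ^+ 2.
have Z0 : 0 <= Z.
  by apply: sumr_ge0 => s _; rewrite -fb -exprMn sqr_ge0.
have YZ : Y ^+ 2 <= b * Z.
  rewrite -sum_lin_dev -sum_boolean_sq.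
  have := sum_CS f (fun s => f s * l s).
  rewrite (eq_bigr (fun s => f s * l s)); last first.
    by move=> s _; rewrite mulrA -expr2 fb.
  rewrite [X in _ <= _ * X -> _](eq_bigr (fun s => f s * l s ^+ 2)) //.
  by move=> s _; rewrite exprMn fb.
have ZQ : Z ^+ 2 <= b * \sum_s l s ^+ 4.
  rewrite -sum_boolean_sq.
  have := sum_CS f (fun s => l s ^+ 2).
  rewrite [X in _ <= _ * X -> _](eq_bigr (fun s => l s ^+ 4)) //.
  by move=> s _; rewrite -exprM.
have [Yz|Yn0] := eqVneq Y 0.
  rewrite Yz expr0n /= mulr0 addr0.
  by apply: mulr_ge0; [exact: exprn_ge0|rewrite !mulr_ge0 ?ler0n].
have Yp : 0 < Y by rewrite lt_def Yn0.
rewrite -(ler_pM2r Yp) -exprSr.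
have Y4 : Y ^+ 4 <= b ^+ 2 * Z ^+ 2.
  have Y20 : 0 <= Y ^+ 2 := sqr_ge0 _.
  by have := ler_pM Y20 Y20 YZ YZ; rewrite -!expr2 -exprM exprMn.
apply: le_trans Y4 _.
have := ler_wpM2l (sqr_ge0 b) ZQ => h; apply: le_trans h _.
have := ler_wpM2l (exprn_ge0 3 b0) Q => h.
rewrite [leLHS](_ : _ = b ^+ 3 * \sum_s l s ^+ 4); last by ring.
by apply: le_trans h _; rewrite -/Y le_eqVlt; apply/orP; left; apply/eqP; ring.
Qed.

End Boolean.

End LevelOne.

(** * The product bound and the dense coset for cross-intersecting families *)

Section CrossIntersecting.
Local Open Scope ring_scope.

Definition ind n (A : {set {perm 'I_n}}) (s : {perm 'I_n}) : rat := (s \in A)%:R.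

Lemma ind_sq n (A : {set {perm 'I_n}}) s : ind A s ^+ 2 = ind A s.
Proof. by rewrite /ind; case: (s \in A); rewrite ?expr1n ?expr0n. Qed.

Lemma sum_ind n (A : {set {perm 'I_n}}) : \sum_s ind A s = #|A|%:R.
Proof.
by rewrite -sum1_card natr_sum [RHS]big_mkcond; apply: eq_bigr => s _; rewrite /ind; case: ifP.
Qed.

Lemma marg_ind n (A : {set {perm 'I_n}}) i j :
  marg (ind A) i j = #|A :&: one_coset i j|%:R.
Proof.
rewrite -sum_ind /marg big_mkcond; apply: eq_bigr => s _.
by rewrite /ind !inE; case: (s i == j); rewrite ?andbT ?andbF.
Qed.

Lemma agr_gt0 n (s t : {perm 'I_n}) : intersect s t -> (0 < agr s t)%N.
Proof. by case/existsP => k e; rewrite /agr (bigD1 k) //= e. Qed.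

(* The truncated inclusion-exclusion [(1 - x)(2 - x)(3 - x) <= 0] for [x > 0]. *)
Lemma bonferroni3 x : (0 < x)%N -> (6 + 3 * x ^_ 2 <= 6 * x ^_ 1 + x ^_ 3)%N.
Proof.
case: x => [//|[//|[//|x]]] _.
by rewrite !ffactnSr !ffactn0 !mul1n !subSS !subn0; nia.
Qed.

(** [bonferroni3] summed over [A] and [B]. The form 6, -6, 3, -1 is regrouped so that, besides the
    small [third_diff], only the total and level-one masses occur. *)
Lemma cross_bonferroni n (A B : {set {perm 'I_n}}) :
  cross_intersecting A B ->
  5 * kform 0 (ind A) (ind B) - 3 * kform 1 (ind A) (ind B)
    + third_diff (ind A) (ind B) <= 0.
Proof.
move=> cAB; rewrite /third_diff.
rewrite (_ : _ + _ = 6 * kform 0 (ind A) (ind B) - 6 * kform 1 (ind A) (ind B)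
  + 3 * kform 2 (ind A) (ind B) - kform 3 (ind A) (ind B)); last by ring.
rewrite /kform !mulr_sumr -sumrB -big_split -sumrB /=; apply: sumr_le0 => s _.
rewrite !mulr_sumr -sumrB -big_split -sumrB /=; apply: sumr_le0 => t _.
rewrite /ind; have [sA|_] := boolP (s \in A); last by rewrite !mul0r !mulr0 ?subr0 ?addr0 ?subr0.
have [tB|_] := boolP (t \in B); last by rewrite !mulr0 !mul0r !mulr0 ?subr0 ?addr0 ?subr0.
have := bonferroni3 (agr_gt0 (cAB _ _ sA tB)).
rewrite -(ler_nat rat) ffactn0 !natrD !natrM /= !mul1r.
by lra.
Qed.

(** * Real inequalities behind the product bound and the dense coset *)

Section Numeric.
Variables (F : realFieldType) (N P T a b X Y S E : F).
Hypotheses (a0 : 0 <= a) (b0 : 0 <= b) (T0 : 0 < T) (N8 : 8 <= N).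
Hypotheses (PE : P = (N - 1) * T) (X0 : 0 <= X) (Y0 : 0 <= Y).
Hypotheses (XB : X <= a * (N * T)) (YB : Y <= b * (N * T)) (SXY : S ^+ 2 <= X * Y).
Hypotheses (EB : E ^+ 2 <= 450 * T ^+ 2 * (a * b)) (SE : 2 * (a * b) + E <= 3 * S).

(** Here [N] is the degree, [P] and [T] are (N-1)! and (N-2)!, [a] and [b] the sizes, [X] and [Y]
    the level-one weights, [S] their correlation and [E] the third difference. If [a * b] exceeds
    [3 * S], then [- E] exceeds [a * b], against [EB]. *)
Lemma numeric_large : 450 * T ^+ 2 < a * b -> 0 < a * b /\ (a * b) ^+ 2 <= 9 * (X * Y).
Proof.
have n8 := N8.
move=> h.
have ab0 : 0 < a * b by apply: (le_lt_trans _ h); rewrite mulr_ge0 ?ler0n ?sqr_ge0.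
have hS : a * b <= 3 * S.
  rewrite leNgt; apply/negP => h2.
  have h4 : (a * b) ^+ 2 <= E ^+ 2.
    rewrite -[E ^+ 2]sqrrN.
    have h5 : 0 <= - E by move: SE h2 ab0; lra.
    by rewrite ler_sqr ?nnegrE ?(ltW ab0) //; move: SE h2 ab0; lra.
  have h3 : 450 * T ^+ 2 * (a * b) < a * b * (a * b) by rewrite ltr_pM2r.
  by move: (le_lt_trans (le_trans h4 EB) h3); rewrite -expr2 ltxx.
split=> //; apply: (@le_trans _ _ ((3 * S) ^+ 2)); last by move: SXY; lra.
by rewrite ler_sqr ?nnegrE; lra.
Qed.

(** For large [a * b], the Bessel bounds on [X] and [Y] give [a * b <= 9 * (N * T) ^+ 2], and
    [N <= 2 * (N - 1)]. *)
Lemma numeric_product_le : a * b <= 36 * P ^+ 2.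
Proof.
have n8 := N8.
have T2 : 0 < T ^+ 2 by rewrite exprn_gt0.
have [small|big] := leP (a * b) (450 * T ^+ 2).
  apply: le_trans small _; rewrite PE.
  rewrite [leRHS](_ : _ = 36 * (N - 1) ^+ 2 * T ^+ 2); last by ring.
  rewrite ler_pM2r //.
  have : 7 ^+ 2 <= (N - 1) ^+ 2 by rewrite ler_sqr ?nnegrE; lra.
  by lra.
have [ab0 h1] := numeric_large big.
have h2 : X * Y <= (a * b) * (N * T) ^+ 2.
  by have := ler_pM X0 Y0 XB YB; lra.
have h3 : (a * b) * (a * b) <= (a * b) * (9 * (N * T) ^+ 2) by lra.
rewrite ler_pM2l // in h3; apply: le_trans h3 _; rewrite PE.
rewrite [leLHS](_ : _ = 9 * N ^+ 2 * T ^+ 2); last by ring.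
rewrite [leRHS](_ : _ = 9 * (2 * (N - 1)) ^+ 2 * T ^+ 2); last by ring.
rewrite ler_pM2r // ler_pM2l // ler_sqr ?nnegrE; lra.
Qed.

Variables (eps : F).
Let e := eps / 18.
Hypotheses (eps0 : 0 < eps) (N1 : 450 < eps * (N - 1) ^+ 2)
  (hab : eps * P ^+ 2 <= a * b).

(** Bounding only [X] by [XB] in [numeric_large] leaves a lower bound for [Y]; 18 is 9 times the
    loss 2 in [N * T <= 2 * P]. *)
Lemma numeric_level_one_ge : 0 < b /\ e * b * P <= Y.
Proof.
have ep := eps0.
have n8 := N8.
have P0 : 0 < P by rewrite PE mulr_gt0 //; lra.
have T2 : 0 < T ^+ 2 by rewrite exprn_gt0.
have big : 450 * T ^+ 2 < a * b.
  apply: (lt_le_trans _ hab); rewrite PE.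
  rewrite [ltRHS](_ : _ = eps * (N - 1) ^+ 2 * T ^+ 2); last by ring.
  by rewrite ltr_pM2r.
have [ab0 h1] := numeric_large big.
have bp : 0 < b.
  by rewrite lt_def b0 andbT; apply: contraTneq ab0 => ->; rewrite mulr0 ltxx.
have ap : 0 < a.
  by rewrite lt_def a0 andbT; apply: contraTneq ab0 => ->; rewrite mul0r ltxx.
split => //.
have h2 : a * b ^+ 2 <= 9 * (N * T * Y).
  by rewrite -(ler_pM2l ap); have := ler_wpM2r Y0 XB; lra.
have h3 : eps * P ^+ 2 * b <= 9 * (N * T * Y).
  by apply: (le_trans _ h2); rewrite (expr2 b) [leRHS]mulrA; apply: ler_wpM2r.
have h4 : N * T <= 2 * P by rewrite PE [leRHS]mulrA ler_pM2r //; lra.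
have h5 : eps * P ^+ 2 * b <= 18 * (P * Y).
  by apply: (le_trans h3 _); have := ler_wpM2r Y0 h4; lra.
by rewrite -(ler_pM2l P0) /e; lra.
Qed.

(** With [Y >= e * b * P] the left side is at least [b ^+ 3] times [e ^+ 3 * P ^+ 3]. The two terms
    on the right are at most a quarter and a half of this: 288 is 4 * 72, and 3456 absorbs 144 * 6
    with [N <= 2 * (N - 1)]. *)
Lemma numeric_no_small_dev (mu := e ^+ 3 / 288 * P ^+ 2) :
  3456 <= e ^+ 3 * (N - 1) -> b <= 6 * P ->
  ~ Y ^+ 3 <= b ^+ 3 * (72 * P * mu + 144 * T * Y).
Proof.
have ep := eps0.
have n8 := N8.
move=> N2 hb h; have [bp Ylow] := numeric_level_one_ge.
have P0 : 0 < P by rewrite PE mulr_gt0 //; lra.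
have T2 : 0 < T ^+ 2 by rewrite exprn_gt0.
have e0 : 0 < e by rewrite /e; lra.
have Y3 : (e * b * P) ^+ 3 <= Y ^+ 3.
  rewrite lerXn2r ?nnegrE //; first by do 2![apply: mulr_ge0; last exact: ltW]; exact: ltW.
have b3 : 0 < b ^+ 3 by rewrite exprn_gt0.
have {}h : e ^+ 3 * P ^+ 3 <= 72 * P * mu + 144 * T * Y.
  rewrite -(ler_pM2l b3); apply: (le_trans _ h); apply: (le_trans _ Y3).
  by rewrite le_eqVlt; apply/orP; left; apply/eqP; ring.
have TY : 144 * T * Y <= 864 * P * (N * T ^+ 2).
  rewrite [leRHS](_ : _ = 144 * T * (6 * P * (N * T))); last by ring.
  apply: ler_wpM2l; first by rewrite mulr_ge0 ?ler0n // ltW.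
  apply: (le_trans YB _); apply: ler_wpM2r => //.
  by rewrite mulr_ge0 // ?(ltW T0) //; lra.
have NT : 864 * (N * T ^+ 2) <= e ^+ 3 * P ^+ 2 / 2.
  rewrite PE.
  rewrite [leRHS](_ : _ = (e ^+ 3 * (N - 1) * (N - 1) / 2) * T ^+ 2); last by ring.
  rewrite [leLHS]mulrA ler_pM2r //.
  have N1p : 0 <= N - 1 by lra.
  by have := ler_wpM2r N1p N2; lra.
have e3P : 0 < e ^+ 3 * P ^+ 3 by rewrite mulr_gt0 ?exprn_gt0.
have := ler_wpM2l (ltW P0) NT; move: h TY e3P.
set w := e ^+ 3 * P ^+ 3.
have -> : 72 * P * mu = w / 4 by rewrite /w /mu; field.
have -> : P * (e ^+ 3 * P ^+ 2 / 2) = w / 2 by rewrite /w; ring.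
by lra.
Qed.

End Numeric.

(** As 17^2 > 288 and [e <= 1], the deviation exceeds [c * P] in absolute value. It cannot be
    negative, because the average [b / N] is below [c * P]. *)
Lemma numeric_dev_large (F : realFieldType) (eps P x u b N : F)
    (e := eps / 18) (c := e ^+ 2 / 17) :
  0 < eps -> eps <= 1 -> 0 < P -> 0 < N -> 0 <= u -> 0 <= b -> b <= 6 * P -> 6 < c * N ->
  x = u - b / N -> e ^+ 3 / 288 * P ^+ 2 < x ^+ 2 -> c * P <= u.
Proof.
move=> eps0 eps1 P0 N0 u0 b0 hb N3 xE hx.
have e0 : 0 < e by rewrite /e; lra.
have e1 : e <= 1 by rewrite /e; lra.
have c0 : 0 < c by rewrite /c divr_gt0 ?exprn_gt0.
have cc : (c * P) ^+ 2 < x ^+ 2.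
  apply: (le_lt_trans _ hx); rewrite exprMn ler_pM2r ?exprn_gt0 //.
  have e4 : e ^+ 4 <= e ^+ 3 by rewrite exprS ler_piMl ?exprn_ge0 // ltW.
  have e30 : 0 < e ^+ 3 by rewrite exprn_gt0.
  by rewrite [leLHS](_ : _ = e ^+ 4 / 289); [lra|rewrite /c; field].
have cP0 : 0 <= c * P by rewrite mulr_ge0 // ltW.
have hd : c * P < `|x|.
  by rewrite -ltr_sqr ?nnegrE ?normr_ge0 // real_normK ?num_real.
have bN : b / N < c * P.
  rewrite ltr_pdivrMr //; apply: (le_lt_trans hb _).
  by rewrite mulrAC ltr_pM2r.
have bN0 : 0 <= b / N by rewrite divr_ge0 // ltW.
by move: hd; rewrite xE; move: (b / N) bN bN0 => v ? ?; case: ger0P => _; lra.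
Qed.

Section Bounds.
Variables (m : nat) (A B : {set {perm 'I_m.+4.+1}}).
Hypotheses (m3 : (3 <= m)%N) (cAB : cross_intersecting A B).
Local Notation N := ((m.+4.+1)%:R : rat).
Local Notation P := ((m.+4`!)%:R : rat).
Local Notation T := ((m.+3`!)%:R : rat).
Local Notation a := (#|A|%:R : rat).
Local Notation b := (#|B|%:R : rat).
Local Notation X := (normsq (dev (ind A))).
Local Notation Y := (normsq (dev (ind B))).
Local Notation S := (\sum_i \sum_j dev (ind A) i j * dev (ind B) i j).
Local Notation E := (third_diff (ind A) (ind B)).

Let T0 : 0 < T. Proof. by rewrite ltr0n fact_gt0. Qed.
Let PE : P = (N - 1) * T.
Proof. by rewrite factS natrM -(natr1 m.+4) addrK. Qed.
Let N8 : 8 <= N. Proof. by rewrite ler_nat; lia. Qed.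

Let XB : X <= a * (N * T).
Proof. by have := level_one_bessel (ind_sq A); rewrite sum_ind. Qed.
Let YB : Y <= b * (N * T).
Proof. by have := level_one_bessel (ind_sq B); rewrite sum_ind. Qed.

Let SXY : S ^+ 2 <= X * Y.
Proof.
rewrite /normsq !pair_big /=.
exact: (@sum_CS _ (fun p => dev (ind A) p.1 p.2) (fun p => dev (ind B) p.1 p.2)).
Qed.

Let EB : E ^+ 2 <= 450 * T ^+ 2 * (a * b).
Proof.
have := third_diff_le (ind A) (ind B) m3.
by rewrite !(sum_boolean_sq (ind_sq _)) !sum_ind.
Qed.

Let SE : 2 * (a * b) + E <= 3 * S.
Proof.
have := cross_bonferroni cAB; rewrite kform0 kform1_dev !sum_ind.
by move: E S a b => x y u v; lra.
Qed.

Lemma cross_product_le : a * b <= 36 * P ^+ 2.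
Proof.
exact: (numeric_product_le T0 N8 PE (normsq_ge0 _) (normsq_ge0 _) XB YB SXY EB SE).
Qed.

(** If no deviation were large, [level_one_fourth] would contradict [numeric_no_small_dev]. *)
Lemma dense_coset_explicit (eps : rat) (e := eps / 18) (c := e ^+ 2 / 17) :
  0 < eps -> eps <= 1 -> 450 < eps * (N - 1) ^+ 2 ->
  3456 <= e ^+ 3 * (N - 1) -> 6 < c * N ->
  eps * P ^+ 2 <= a * b -> b <= 6 * P ->
  exists k l, c * P <= #|B :&: one_coset k l|%:R.
Proof.
move=> eps0 eps1 N1 N2 N3 hab hb.
have [|none] := boolP [exists k, exists l, e ^+ 3 / 288 * P ^+ 2 < dev (ind B) k l ^+ 2].
  case/existsP => k /existsP[l hkl]; exists k, l.
  apply: (numeric_dev_large eps0 eps1 _ _ (ler0n _ _) (ler0n _ _) hb N3 _ hkl).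
  - by rewrite ltr0n fact_gt0.
  - by rewrite ltr0n.
  - by rewrite /dev sum_ind marg_ind.
have mu k l : dev (ind B) k l ^+ 2 <= e ^+ 3 / 288 * P ^+ 2.
  by move: none; rewrite negb_exists => /forallP/(_ k); rewrite negb_exists
    => /forallP/(_ l); rewrite -leNgt.
have := level_one_fourth (ind_sq B) mu; rewrite sum_ind => h.
case: (numeric_no_small_dev (ler0n _ _) (ler0n _ _) T0 N8 PE (normsq_ge0 _)
   XB YB SXY EB SE eps0 N1 hab N2 hb h).
Qed.

End Bounds.

End CrossIntersecting.

(** * Derangement numbers and permutations of a coset meeting given permutations *)

Section Derangements.

Lemma lift_tperm_mul_inj n (i k : 'I_n.+1) (r : {perm 'I_n.+1}) :
  injective (fun t => lift_perm i i t * tperm i k * r)%g.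
Proof. by move=> s t /mulIg/mulIg/lift_perm_inj. Qed.

Lemma intersectN n (s r : {perm 'I_n}) :
  reflect (forall k, s k != r k) (~~ intersect s r).
Proof. by rewrite negb_exists; exact: forallP. Qed.

Lemma card_fixed_or_not n (q : 'I_n.+1) :
  #|[set t : {perm 'I_n.+1} | [forall p, (p != q) ==> (t p != p)]]| =
  derangements n.+1 + derangements n.
Proof.
rewrite -(cardsID (one_coset q q)) addnC; congr (_ + _).
  apply: eq_card => t; rewrite !inE; apply/andP/forallP.
    move=> [tq /forallP h] p; have [->//|pq] := eqVneq p q.
    by have := h p; rewrite pq.
  by move=> h; split; [exact: h|apply/forallP => p; rewrite h implybT].
rewrite -[RHS](card_imset _ (@lift_perm_inj _ q q)); apply: eq_card => t.
rewrite !inE; apply/andP/imsetP => [[/forallP h /eqP tq]|[u]].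
  have [u tu] := lift_permP tq; exists u => //; rewrite inE; apply/forallP => p.
  have := h (lift q p); rewrite eq_sym neq_lift /= tu lift_perm_lift.
  by rewrite (inj_eq (@lift_inj _ _)).
rewrite inE => /forallP h ->; rewrite lift_perm_id; split => //.
apply/forallP => p; case: (unliftP q p) => [p' ->|->]; last by rewrite eqxx.
by rewrite lift_perm_lift (inj_eq (@lift_inj _ _)) h implybT.
Qed.

(** For such [s], the product [s * r^-1 * tperm i k] fixes [i]. Deleting [i] leaves a permutation
    whose only possible fixed point is [q], the point corresponding to [k]. *)
Lemma card_avoid n (i j : 'I_n.+2) (r : {perm 'I_n.+2}) : r i != j ->
  #|[set s in one_coset i j | ~~ intersect s r]| =
  derangements n.+1 + derangements n.
Proof.
move=> rij; set k := (r^-1)%g j.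
have rk : r k = j by rewrite /k permKV.
have ik : i != k by apply: contraNneq rij => ->; rewrite rk.
case: (unliftP i k) (ik) => [q kq|->]; last by rewrite eqxx.
move=> _; rewrite -(card_fixed_or_not q).
rewrite -[RHS](card_imset _ (@lift_tperm_mul_inj _ i k r)).
have rr x : r ((r^-1)%g x) = x by rewrite permKV.
apply: eq_card => s; rewrite !inE; apply/andP/imsetP => [[/eqP si /intersectN h]|[t]].
  have ui : (s * r^-1 * tperm i k)%g i = i by rewrite !permM si -/k tpermR.
  have [t ut] := lift_permP ui; exists t; last first.
    by rewrite -ut -(mulgA _ (tperm i k) (tperm i k)) tperm2 mulg1 mulgKV.
  rewrite inE; apply/forallP => p; apply/implyP => pq; apply/eqP => tp.
  have := lift_perm_lift i i t p; rewrite tp -ut !permM => /(canRL (tpermK _ _)).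
  rewrite tpermD ?neq_lift //; last by rewrite kq (inj_eq (@lift_inj _ _)) eq_sym.
  by move=> /(congr1 r); rewrite rr => e; have := h (lift i p); rewrite e eqxx.
rewrite inE => /forallP h ->; rewrite !permM lift_perm_id tpermL rk; split => //.
apply/intersectN => p; rewrite !permM (inj_eq perm_inj).
have [->|pi] := eqVneq p i; first by rewrite lift_perm_id tpermL eq_sym.
have [->|pk] := eqVneq p k.
  rewrite -[X in _ != X](tpermL i k) (inj_eq perm_inj).
  by rewrite -[X in _ != X](lift_perm_id i i t) (inj_eq perm_inj) eq_sym.
case: (unliftP i p) pi pk => [p' ->|->]; last by rewrite eqxx.
move=> _ pk; have p'q : p' != q by move: pk; rewrite kq (inj_eq (@lift_inj _ _)).
rewrite -[X in _ != X](@tpermD _ i k (lift i p')) ?neq_lift //; last first.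
  by rewrite kq (inj_eq (@lift_inj _ _)) eq_sym.
rewrite (inj_eq perm_inj) lift_perm_lift (inj_eq (@lift_inj _ _)).
by have := h p'; rewrite p'q.
Qed.

(** Derangements are split by the image of 0; [card_avoid] with [r] the identity counts each
    class. *)
Lemma derangementsSS n :
  derangements n.+2 = n.+1 * (derangements n.+1 + derangements n).
Proof.
rewrite {1}/derangements -sum1_card.
rewrite (partition_big (fun s : {perm 'I_n.+2} => s ord0) (fun k => k != ord0)); last first.
  by move=> s; rewrite inE => /forallP.
rewrite (eq_bigr (fun=> derangements n.+1 + derangements n)).
  by rewrite sum_nat_const cardC1 card_ord.
move=> k k0; rewrite -(@card_avoid _ ord0 k 1%g) ?perm1 1?eq_sym // sum1dep_card.
apply: eq_card => s; rewrite !inE andbC; congr (_ && _).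
by apply/forallP/intersectN => h p; have := h p; rewrite perm1.
Qed.

Lemma derangements0 : derangements 0 = 1.
Proof.
rewrite /derangements (_ : [set s | _] = [set: {perm 'I_0}]); first by rewrite cardsT card_Sn.
by apply/setP => s; rewrite !inE; apply/forallP; case.
Qed.

Lemma derangements1 : derangements 1 = 0.
Proof.
apply/eqP; rewrite cards_eq0; apply/eqP/setP => s; rewrite !inE.
by apply/negbTE/forallPn; exists ord0; rewrite [s _]ord1.
Qed.

Lemma derangements_bounds n :
  (n.+2)`! <= 3 * derangements n.+2 /\ 2 * derangements n.+2 <= (n.+2)`!.
Proof.
(* The recurrence has order two, so two consecutive cases are carried through the induction. *)
suff : ((n.+2)`! <= 3 * derangements n.+2 /\ 2 * derangements n.+2 <= (n.+2)`!) /\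
  ((n.+3)`! <= 3 * derangements n.+3 /\ 2 * derangements n.+3 <= (n.+3)`!) by case.
elim: n => [|n [IH1 IH2]].
  by rewrite !derangementsSS derangements1 derangements0.
split=> //; rewrite (derangementsSS n.+2).
have e1 : (n.+4)`! = n.+4 * (n.+3)`! by rewrite factS.
have e2 : (n.+3)`! = n.+3 * (n.+2)`! by rewrite factS.
by move: IH1 IH2 => [? ?] [? ?]; nia.
Qed.

Lemma card_extA n (i j : 'I_n.+2) (r : {perm 'I_n.+2}) : r i != j ->
  #|extA i j r| = (n.+1)`! - derangements n.+1 - derangements n.
Proof.
move=> rij; rewrite -subnDA -(card_avoid rij) -(card_one_coset i j).
rewrite -(cardsID (extA i j r) (one_coset i j)).
have -> : one_coset i j :&: extA i j r = extA i j r.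
  by apply/setIidPr/subsetP => s; rewrite !inE => /andP[].
have -> : one_coset i j :\: extA i j r = [set s in one_coset i j | ~~ intersect s r].
  by apply/setP => s; rewrite !inE negb_and; case: (s i == j); rewrite ?andbF ?andbT.
by rewrite addnK.
Qed.

Lemma card_extB n (i j : 'I_n.+1) (r : {perm 'I_n.+1}) : r i != j ->
  #|extB i j r| = n`! + 1.
Proof.
move=> rij; rewrite cardsU card_one_coset cards1 (_ : _ :&: _ = set0) ?cards0 ?subn0 //.
apply/setP => s; rewrite !inE; apply/negbTE/negP => /andP[/eqP si /eqP e].
by rewrite -e si eqxx in rij.
Qed.

(** Iterating [p |-> r1^-1 (r2 p)] from a disagreement stays among disagreements; one of the first
    three points meets both conditions. *)
Lemma exists_diff n (i j : 'I_n) (r1 r2 : {perm 'I_n}) :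
  r1 != r2 -> r2 i != j -> exists p, [/\ p != i, r1 p != r2 p & r1 p != j].
Proof.
move=> r12 r2i; have [p rp] : exists p, r1 p != r2 p.
  by apply/existsP; apply: contraNT r12 => /existsPn h; apply/eqP/permP => p;
     apply/eqP; have := h p; rewrite negbK.
pose q := (r1^-1)%g (r2 p).
have rq : r1 q = r2 p by rewrite /q permKV.
have qp : q != p by apply: contraNneq rp => e; rewrite -{1}e rq.
have rq2 : r1 q != r2 q by rewrite rq (inj_eq perm_inj) eq_sym.
pose q' := (r1^-1)%g (r2 q).
have rq' : r1 q' = r2 q by rewrite /q' permKV.
have qq' : q' != q by apply: contraNneq rq2 => e; rewrite -{1}e rq'.
have rq'2 : r1 q' != r2 q' by rewrite rq' (inj_eq perm_inj) eq_sym.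
have [pi|pi] := eqVneq p i.
  by exists q; rewrite -pi qp rq2 rq pi.
have [pj|pj] := eqVneq (r1 p) j; last by exists p.
have [qi|qi] := eqVneq q i.
  exists q'; rewrite -qi qq' rq'2 rq' qi; split => //.
exists q; split => //; apply: contraNneq qp => e.
by rewrite -(inj_eq (@perm_inj _ r1)) e pj.
Qed.

(** It suffices to find [derangements n] members of [extA i j r1] avoiding [r2]. They send [i] to
    [j], agree with [r1] at [p], and are deranged relative to [r2] on the other [n] points. *)
Lemma card_meet2_le n (i j : 'I_n.+2) (r1 r2 : {perm 'I_n.+2}) :
  r1 != r2 -> r1 i != j -> r2 i != j ->
  #|extA i j r1 :&: extA i j r2| + derangements n <=
  (n.+1)`! - derangements n.+1 - derangements n.
Proof.
move=> r12 r1i r2i; rewrite -(card_extA r1i) -(cardsID (extA i j r2) (extA i j r1)).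
rewrite leq_add2l; have [p [pi rp rpj]] := exists_diff r12 r2i.
(* [rb] corrects [r2] by two transpositions of values to get [i -> j] and [p -> r1 p], keeping the
   values of [r2] that are neither [j] nor [r1 p] at the other points. *)
pose ra := (r2 * tperm (r2 i) j)%g; pose rb := (ra * tperm (ra p) (r1 p))%g.
have rai : ra i = j by rewrite permM tpermL.
have rbp : rb p = r1 p by rewrite permM tpermL.
have rbi : rb i = j.
  by rewrite permM rai tpermD // -1?rai ?(inj_eq perm_inj) //.
have rbE q : q != i -> q != p -> r2 q != j -> r2 q != r1 p -> rb q = r2 q.
  move=> qi qp qj qr; have e : ra q = r2 q.
    by rewrite permM tpermD // 1?eq_sym // (inj_eq perm_inj).
  by rewrite permM tpermD // 1?eq_sym ?e // -e (inj_eq perm_inj).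
case: (unliftP i p) (pi) => [p' pp'|->]; last by rewrite eqxx.
move=> _; pose phi (v : {perm 'I_n}) := (lift_perm i i (lift_perm p' p' v) * rb)%g.
have phi_inj : injective phi by move=> u v /mulIg/lift_perm_inj/lift_perm_inj.
rewrite /derangements -(card_imset _ phi_inj); apply/subset_leq_card/subsetP => _ /imsetP[v + ->].
rewrite inE => /forallP dv.
have phii : phi v i = j by rewrite permM lift_perm_id rbi.
have phip : phi v p = r1 p by rewrite permM {1}pp' lift_perm_lift lift_perm_id -pp' rbp.
rewrite !inE phii eqxx /=; apply/andP; split; last first.
  by apply/existsP; exists p; rewrite phip.
apply/intersectN => q; have [->|qi] := eqVneq q i; first by rewrite phii eq_sym.
have [->|qp] := eqVneq q p; first by rewrite phip.
apply/eqP => e.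
have qj : r2 q != j by rewrite -e -phii (inj_eq perm_inj).
have qr : r2 q != r1 p by rewrite -e -phip (inj_eq perm_inj).
move: e; rewrite -(rbE q qi qp qj qr) permM => /perm_inj.
case: (unliftP i q) qi qp => [q' ->|->]; last by rewrite eqxx.
move=> _; rewrite pp' (inj_eq (@lift_inj _ _)) lift_perm_lift => qp /lift_inj.
case: (unliftP p' q') qp => [q'' ->|->]; last by rewrite eqxx.
by move=> _; rewrite lift_perm_lift => /lift_inj/eqP; rewrite (negbTE (dv _)).
Qed.

End Derangements.

(** * From a dense coset to concentration in it *)

Section Stability.
Local Open Scope ring_scope.

Lemma cross_sym n (A B : {set {perm 'I_n}}) :
  cross_intersecting A B -> cross_intersecting B A.
Proof.
move=> cAB s t sB tA; have /existsP[k e] := cAB _ _ tA sB.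
by apply/existsP; exists k; rewrite eq_sym.
Qed.

(* Swapping the values [j] and [k] identifies the [i -> j] part of [A] and the
   [i -> k] part of [B] with families on one and the same domain. *)
Lemma cross_transport n (A B : {set {perm 'I_n.+1}}) i j k :
  j != k -> cross_intersecting A B ->
  exists A' B' : {set {perm 'I_n}}, [/\ cross_intersecting A' B',
    #|A'| = #|A :&: one_coset i j| & #|B'| = #|B :&: one_coset i k|].
Proof.
move=> jk cAB.
exists [set s | lift_perm i j s \in A], [set t | (lift_perm i j t * tperm j k)%g \in B].
split.
- move=> s t; rewrite !inE => sA tB; have /existsP[p] := cAB _ _ sA tB.
  case: (unliftP i p) => [q ->|->]; last first.
    by rewrite permM !lift_perm_id tpermL (negbTE jk).
  rewrite permM !lift_perm_lift => /eqP e; apply/existsP; exists q.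
  have jt : j != lift j (t q) by exact: neq_lift.
  have kt : k != lift j (t q).
    apply/eqP => e'; move: e; rewrite -e' tpermR => /eqP.
    by rewrite eq_sym (negbTE (neq_lift _ _)).
  by move: e; rewrite (tpermD jt kt) => /lift_inj ->.
- rewrite -(card_imset _ (@lift_perm_inj _ i j)); apply: eq_card => s.
  apply/imsetP/setIP => [[t]|[sA]].
    by rewrite !inE => tA ->; rewrite lift_perm_id.
  rewrite inE => /eqP/lift_permP[t st]; exists t => //; by rewrite inE -st.
- rewrite -(card_imset _ (inj_comp (mulIg (tperm j k)) (@lift_perm_inj _ i j))).
  apply: eq_card => s; apply/imsetP/setIP => [[t]|[sB]].
    by rewrite !inE => tB -> /=; rewrite permM lift_perm_id tpermL.
  rewrite inE => /eqP si; have e : (s * tperm j k)%g i = j by rewrite permM si tpermR.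
  have [t st] := lift_permP e; exists t; last by rewrite /= -st -mulgA tperm2 mulg1.
  by rewrite inE -st -mulgA tperm2 mulg1.
Qed.

Lemma eventually_ge (x : rat) : exists n0, forall n, (n0 <= n)%N -> x <= n%:R.
Proof.
exists (Num.bound `|x|) => n hn; apply: le_trans (ler_norm x) _.
by apply: le_trans (ltW (archi_boundP (normr_ge0 x))) _; rewrite ler_nat.
Qed.

Lemma cross_bound n (A B : {set {perm 'I_n.+1}}) : (7 <= n)%N ->
  cross_intersecting A B -> #|A|%:R * #|B|%:R <= 36 * (n`!)%:R ^+ 2 :> rat.
Proof.
move=> n7 cAB; have [m nm] : exists m, n = m.+4 by clear -n7; exists (n - 4)%N; lia.
by subst n; exact: (@cross_product_le m A B).
Qed.

Lemma ler_div_mul (F : realFieldType) (k : nat) (u x : F) :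
  0 < u -> k%:R / u <= x -> k%:R <= u * x.
Proof. by move=> u0; rewrite ler_pdivrMr // mulrC. Qed.

Lemma eventually_ge_mul (k : nat) (u : rat) : 0 < u ->
  exists n0, forall n, (n0 <= n)%N -> k%:R <= u * n%:R.
Proof.
move=> u0; have [n0 h] := eventually_ge (k%:R / u).
by exists n0 => n /h; exact: ler_div_mul.
Qed.

Lemma numeric_eps_sq (F : realFieldType) (eps x : F) :
  0 < eps -> 1 <= x -> 451 <= eps * x -> 450 < eps * x ^+ 2.
Proof.
move=> eps0 x1 h; have : eps * x <= eps * x ^+ 2; last by lra.
by rewrite ler_pM2l // expr2 ler_peMl //; lra.
Qed.

Lemma numeric_c_le (F : realFieldType) (eps : F) (e := eps / 18) :
  0 < eps -> eps <= 1 -> [/\ 0 < e, 0 < e ^+ 2 / 17 & e ^+ 2 / 17 <= 3^-1].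
Proof.
move=> eps0 eps1; have e0 : 0 < e by rewrite /e; lra.
have e1 : e <= 1 by rewrite /e; lra.
have e20 : 0 < e ^+ 2 by rewrite exprn_gt0.
have : e ^+ 2 <= 1 by rewrite exprn_ile1 // ltW.
by split => //; lra.
Qed.

(** The density [c] depends on [eps] alone; for large [n] all size conditions of
    [dense_coset_explicit] hold. *)
Lemma dense_coset (eps : rat) : 0 < eps -> eps <= 1 ->
  exists c : rat, [/\ 0 < c, c <= 3^-1 & exists n0, forall n, (n0 <= n)%N ->
    forall A B : {set {perm 'I_n.+1}}, cross_intersecting A B ->
    eps * (n`!)%:R ^+ 2 <= #|A|%:R * #|B|%:R -> #|B|%:R <= 6 * (n`!)%:R :> rat ->
    exists k l, c * (n`!)%:R <= #|B :&: one_coset k l|%:R].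
Proof.
have ge1 k : 1 <= (k.+1)%:R :> rat by rewrite ler1n.
move=> eps0 eps1; have [e0 c0 c1] := numeric_c_le eps0 eps1.
have [n1 h1] := eventually_ge_mul 451 eps0.
have [n2 h2] := eventually_ge_mul 3456 (exprn_gt0 3 e0).
have [n3 h3] := eventually_ge_mul 7 c0.
exists ((eps / 18) ^+ 2 / 17); split => //.
exists (n1 + n2 + n3 + 7)%N => n hn A B cAB hab hb.
have [le1 le2 le3] : [/\ n1 <= n, n2 <= n & n3 <= n]%N by clear -hn; split; lia.
move: (h1 n le1) (h2 n le2) (h3 n le3) => {}h1 {}h2 {}h3.
have [m nm] : exists m, n = m.+4 by clear -hn; exists (n - 4)%N; lia.
subst n; have nE : (m.+4)%:R = (m.+4.+1)%:R - 1 :> rat by rewrite -[in RHS]natr1 addrK.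
rewrite nE in h1 h2 h3.
have N1 := ge1 m.+3; rewrite nE in N1.
apply: (@dense_coset_explicit m A B _ cAB eps eps0 eps1 _ h2 _ hab hb).
- by clear -hn; lia.
- exact: (numeric_eps_sq eps0 N1 h1).
- move: c0 h3; move: (_ / 17) (m.+4.+1)%:R => c x; lra.
Qed.

Lemma card_split_coset n (A : {set {perm 'I_n}}) k l :
  #|A|%:R = #|A :&: one_coset k l|%:R + #|A :\: one_coset k l|%:R :> rat.
Proof. by rewrite -natrD cardsID. Qed.

Lemma card_outside n (A : {set {perm 'I_n}}) k l :
  #|A :\: one_coset k l|%:R = \sum_(j | j != l) #|A :&: one_coset k j|%:R :> rat.
Proof.
apply: (addrI (#|A :&: one_coset k l|%:R)); rewrite -card_split_coset.
rewrite -sum_ind -(sum_marg_r _ k) (bigD1 l) //= marg_ind; congr (_ + _).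
by apply: eq_bigr => j _; rewrite marg_ind.
Qed.

(** For each of the [n.+1] values [j] other than [l], [cross_transport] and [cross_bound] limit the
    part [k -> j] of [A]. *)
Lemma outside_le n (A B : {set {perm 'I_n.+2}}) k l (c : rat) : (7 <= n)%N ->
  cross_intersecting A B -> c * (n.+1`!)%:R <= #|B :&: one_coset k l|%:R ->
  c * #|A :\: one_coset k l|%:R <= 36 * (n`!)%:R.
Proof.
move=> n7 cAB hB; set T : rat := (n`!)%:R.
have T0 : 0 < T by rewrite ltr0n fact_gt0.
have P0 : 0 < (n.+1)%:R * T by apply: mulr_gt0 => //; rewrite ltr0n.
rewrite -(ler_pM2r P0) card_outside mulr_sumr mulr_suml.
have -> : 36 * T * ((n.+1)%:R * T) = \sum_(j : 'I_n.+2 | j != l) (36 * T ^+ 2).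
  by rewrite sumr_const cardC1 card_ord /= -[RHS]mulr_natl; ring.
apply: ler_sum => j jl.
have [A' [B' [cAB' eA eB]]] := cross_transport k jl cAB.
have := cross_bound n7 cAB'; rewrite eA eB -/T.
apply: le_trans; rewrite [leLHS]mulrAC [leLHS]mulrC.
by apply: ler_wpM2l; [exact: ler0n|move: hB; rewrite factS natrM].
Qed.

Lemma numeric_b6 (F : realFieldType) (c P a b N : F) :
  a * b <= 36 * P ^+ 2 -> c * N * P <= a -> 0 < P -> 0 <= b -> 6 <= c * N -> b <= 6 * P.
Proof.
move=> ab hA P0 b0 cN; have a6 : 6 * P <= a by apply: (le_trans _ hA); rewrite ler_pM2r.
by have := ler_wpM2r b0 a6 => h; rewrite -(ler_pM2l P0); lra.
Qed.

Lemma numeric_sparse (F : realFieldType) (c c' P T a u v N : F) : 0 < c' -> c' <= 3^-1 ->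
  c * N * P <= a -> c' * v <= 36 * T -> a = u + v -> u <= P -> T <= P -> 0 < P ->
  ~ 38 <= c' * c * N.
Proof.
move=> c'0 c'1 hA hv av hu TP P0 cN; rewrite av in hA.
have h1 : c' * (c * N * P) <= c' * (u + v) by rewrite ler_pM2l.
have h2 : c' * u <= P.
  by apply: (@le_trans _ _ (c' * P)); [rewrite ler_pM2l|rewrite ler_piMl //; lra].
have h3 : 38 * P <= c' * c * N * P by rewrite ler_pM2r.
by lra.
Qed.

(** Were the product larger, [B] would be dense in a coset, so [outside_le] would leave few elements
    of [A] outside it. Then [A] has size O(n!), against a positive fraction of (n+1)!. *)
Lemma sparse_partner (c : rat) : 0 < c -> c <= 3^-1 ->
  exists n0, forall n, (n0 <= n)%N -> forall A B : {set {perm 'I_n.+1}},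
    cross_intersecting A B -> c * (n.+1`!)%:R <= #|A|%:R ->
    #|A|%:R * #|B|%:R <= c / 3 * (n`!)%:R ^+ 2.
Proof.
move=> c0 c1; have eps0 : 0 < c / 3 by lra.
have eps1 : c / 3 <= 1 by lra.
have [c' [c'0 c'1 [n1 hn1]]] := dense_coset eps0 eps1.
have [n2 hn2] := eventually_ge_mul 6 c0.
have [n3 hn3] := eventually_ge_mul 38 (mulr_gt0 c'0 c0).
exists (n1 + n2 + n3 + 8)%N => n hn A B cAB hA.
have [le1 le2 le3] : [/\ n1 <= n, n2 <= n & n3 <= n]%N by clear -hn; split; lia.
move: (hn1 n le1) (hn2 n le2) (hn3 n le3) => {}hn1 {}hn2 {}hn3.
rewrite leNgt; apply/negP => big.
have [m nm] : exists m, n = m.+1 by clear -hn; exists (n - 1)%N; lia.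
subst n.
have hA' : c * (m.+1)%:R * ((m.+1)`!)%:R <= #|A|%:R.
  apply: (le_trans _ hA); rewrite (factS m.+1) natrM mulrA ler_pM2r ?ltr0n ?fact_gt0 //.
  by rewrite ler_pM2l // ler_nat.
have n7 : (7 <= m.+1)%N by clear -hn; lia.
have n7' : (7 <= m)%N by clear -hn; lia.
have ab := cross_bound n7 cAB.
have P0 : 0 < ((m.+1)`!)%:R :> rat by rewrite ltr0n fact_gt0.
have b6 : #|B|%:R <= 6 * ((m.+1)`!)%:R :> rat.
  move: ab hA' P0 (ler0n rat #|B|) hn2; move: _`!%:R #|A|%:R #|B|%:R (m.+1)%:R.
  by move=> P a b N; exact: numeric_b6.
have [k [l hB]] := hn1 A B cAB (ltW big) b6.
have out := outside_le n7' cAB hB.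
have sp := card_split_coset A k l.
have inC : #|A :&: one_coset k l|%:R <= ((m.+1)`!)%:R :> rat.
  by rewrite ler_nat -(card_one_coset k l) subset_leq_card // subsetIr.
have TP : (m`!)%:R <= ((m.+1)`!)%:R :> rat by rewrite ler_nat factS leq_pmull.
move: hA' out sp inC TP P0 hn3; move: _`!%:R (m`!)%:R #|A|%:R #|_ :&: _|%:R #|_ :\: _|%:R (m.+1)%:R.
by move=> P T a u v N; exact: numeric_sparse.
Qed.

End Stability.

(** [derangementsSS] transfers the bounds on [derangements n.+2] to the subtracted sum, placing it
    between one and two thirds of (n+1)!. *)
Lemma extA_card_bounds n : 2 <= n ->
  (n.+1)`! <= 3 * ((n.+1)`! - derangements n.+1 - derangements n) /\
  3 * ((n.+1)`! - derangements n.+1 - derangements n) <= 2 * (n.+1)`!.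
Proof.
move=> n2; have [] := derangements_bounds n; rewrite derangementsSS factS -subnDA.
move: (derangements n.+1 + derangements n) (n.+1)`! => D P h1 h2.
have h3 : 3 * D <= 2 * P.
  rewrite -(@leq_pmul2l (2 * n.+1)) //; move: h2 n2; clear; nia.
have h4 : P <= 3 * D by rewrite -(@leq_pmul2l n.+1) //; move: h1; clear; nia.
by clear -h3 h4; lia.
Qed.

Lemma cross_subset_extA n (A B : {set {perm 'I_n}}) k l r :
  cross_intersecting A B -> r \in B -> A :&: one_coset k l \subset extA k l r.
Proof.
move=> cAB rB; apply/subsetP => s /setIP[sA]; rewrite !inE => -> /=; exact: cAB.
Qed.

(** * Extremal pairs around a common dense coset *)

Section EndGame.
Local Open Scope ring_scope.

Lemma numeric_outside (F : realFieldType) (c a s N T : F) :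
  0 < c -> 0 < N -> 0 < T -> 0 <= s -> c * (N * T) <= a ->
  a * s <= N * (c / 3 * T ^+ 2) -> 3 * s <= T.
Proof.
move=> c0 N0 T0 s0 h1 h2; have h3 := le_trans (ler_wpM2r s0 h1) h2.
have w0 : 0 < c * (N * T) by rewrite !mulr_gt0.
by rewrite -(ler_pM2l w0); lra.
Qed.

(** The part of [A] in the coset has density [c] in a copy of the smaller group, so [sparse_partner]
    applies to each other value [j]. The bound n!/3 is what [derangements n] dominates in
    [one_side]. *)
Lemma card_outside_small (c : rat) : 0 < c -> c <= 3^-1 ->
  exists n0, forall n, (n0 <= n)%N -> forall (A B : {set {perm 'I_n.+2}}) k l,
    cross_intersecting A B -> c * (n.+1`!)%:R <= #|A :&: one_coset k l|%:R ->
    (3 * #|B :\: one_coset k l| <= n`!)%N.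
Proof.
move=> c0 c1; have [n0 hn0] := sparse_partner c0 c1.
exists n0 => n /hn0 {}hn0 A B k l cAB hA; rewrite -(ler_nat rat) natrM.
apply: (numeric_outside (N := (n.+1)%:R) c0 _ _ (ler0n _ _)); first by rewrite ltr0n.
- by rewrite ltr0n fact_gt0.
- by move: hA; rewrite factS natrM; apply.
rewrite card_outside mulr_sumr.
have -> : (n.+1)%:R * (c / 3 * (n`!)%:R ^+ 2) =
    \sum_(j : 'I_n.+2 | j != l) (c / 3 * (n`!)%:R ^+ 2).
  by rewrite sumr_const cardC1 card_ord /= -[RHS]mulr_natl.
apply: ler_sum => j jl; rewrite eq_sym in jl.
have [A' [B' [cAB' eA eB]]] := cross_transport k jl cAB.
by rewrite -eA -eB; apply: (hn0 A' B' cAB'); rewrite eA.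
Qed.

(** One element [r] of [B] outside the coset forces [A] into [extA k l r], and the assumed product
    leaves no room for a proper subset in either family. A second one costs [A] at least
    [derangements n] elements, while [B] gains at most that many. *)
Lemma one_side (c : rat) : 0 < c -> c <= 3^-1 ->
  exists n0, forall n, (n0 <= n)%N -> forall (A B : {set {perm 'I_n.+2}}) k l,
    cross_intersecting A B -> c * (n.+1`!)%:R <= #|A :&: one_coset k l|%:R ->
    A \subset one_coset k l -> ~~ (B \subset one_coset k l) ->
    (((n.+1)`! - derangements n.+1 - derangements n) * ((n.+1)`! + 1) <= #|A| * #|B|)%N ->
    exists r : {perm 'I_n.+2}, [/\ r k != l, A = extA k l r & B = extB k l r].
Proof.
move=> c0 c1; have [n0 hn0] := card_outside_small c0 c1.
exists (n0 + 2)%N => n hn A B k l cAB hA sA sB big.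
have {hn0} small := hn0 n (leq_trans (leq_addr _ _) hn) A B k l cAB hA.
have n2 : (2 <= n)%N := leq_trans (leq_addl _ _) hn.
have [M1 M2] := extA_card_bounds n2.
have P0 := fact_gt0 n.+1.
clear hA c0 c1 hn.
have AI : A :&: one_coset k l = A by apply/setIidPl.
have inC : (#|B :&: one_coset k l| <= (n.+1)`!)%N.
  by rewrite -(card_one_coset k l) subset_leq_card // subsetIr.
have Bsplit := cardsID (one_coset k l) B.
have /subsetPn[r rB rC] := sB; have rkl : r k != l by move: rC; rewrite inE.
have Aext : A \subset extA k l r by rewrite -AI; exact: (cross_subset_extA k l cAB rB).
have AM := subset_leq_card Aext; rewrite card_extA // in AM.
have rD : r \in B :\: one_coset k l by rewrite inE rC.
have [s1|s1] := leqP #|B :\: one_coset k l| 1.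
  have BD : B :\: one_coset k l = [set r].
    by apply/eqP; rewrite eq_sym eqEcard sub1set rD cards1.
  have s1' : #|B :\: one_coset k l| = 1%N by rewrite BD cards1.
  rewrite s1' in Bsplit.
  exists r; split => //.
    apply/eqP; rewrite eqEcard Aext card_extA //.
    move: big AM Bsplit inC M1 P0; move: #|B :&: _| #|B| #|A| => u b a.
    move: ((n.+1)`! - derangements n.+1 - derangements n)%N => M; move: (n.+1)`! => P.
    by clear; nia.
  have CB : B :&: one_coset k l = one_coset k l.
    apply/eqP; rewrite eqEcard subsetIr card_one_coset.
    move: big AM Bsplit inC M1 P0; move: #|B :&: _| #|B| #|A| => u b a.
    move: ((n.+1)`! - derangements n.+1 - derangements n)%N => M; move: (n.+1)`! => P.
    by clear; nia.
  by rewrite /extB -CB -BD setID.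
exfalso.
have : (0 < #|(B :\: one_coset k l) :\ r|)%N.
  by move: s1; rewrite (cardsD1 r) rD.
case/card_gt0P => r2; rewrite !inE => /and3P[r2r r2kl r2B].
have Aext2 : A \subset extA k l r2 by rewrite -AI; exact: (cross_subset_extA k l cAB r2B).
have := subset_leq_card (_ : A \subset extA k l r :&: extA k l r2).
rewrite subsetI Aext Aext2 => /(_ isT) A2.
have := card_meet2_le (_ : r != r2) rkl r2kl; rewrite eq_sym r2r => /(_ isT) loss.
have [m nm] : exists m, n = m.+2 by clear -n2; exists (n - 2)%N; lia.
have := derangements_bounds m; rewrite -nm => -[d1 _].
have d0 := fact_gt0 n.
move: big A2 loss Bsplit inC M1 M2 P0 small d1 d0.
move: #|extA _ _ _ :&: _| #|B :&: _| #|B :\: _| #|B| #|A| => v u s b a.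
move: ((n.+1)`! - derangements n.+1 - derangements n)%N => M.
move: (n.+1)`! (derangements n) n`! => P d T.
clear; move=> big A2 loss Bs inC M1 M2 P0 small d1 d0.
have sd : (s <= d)%N by lia.
have h1 : (a * b <= (M - d) * (P + d))%N by apply: leq_mul; lia.
have dM : (d <= M)%N by lia.
(* Since [M <= P], the gain [M * d] does not exceed the loss [d * P]. *)
have h2 : ((M - d) * (P + d) <= M * P)%N.
  have -> : ((M - d) * (P + d) = M * P + M * d - d * P - d * d)%N.
    by nia.
  by nia.
by nia.
Qed.

Lemma numeric_both_out (F : realFieldType) (c M P T N a b u v w x : F) :
  0 < c -> 0 < T -> P = N * T -> 648 <= c * N -> P <= 3 * M -> 3 * M <= 2 * P ->
  0 <= u -> 0 <= v -> 0 <= w -> 0 <= x ->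
  a = u + v -> b = w + x -> u <= M -> w <= M -> c * v <= 36 * T -> c * x <= 36 * T ->
  a * b < M * (P + 1).
Proof.
move=> c0 T0 PE cN M1 M2 u0 v0 w0 x0 -> -> uM wM hv hx.
have N0 : 0 < N by rewrite -(pmulr_rgt0 _ c0); lra.
have P0 : 0 < P by rewrite PE mulr_gt0.
have out z : c * z <= 36 * T -> z <= P / 18.
  move=> hz; rewrite -(ler_pM2l c0); apply: (le_trans hz _); rewrite PE.
  by have := ler_wpM2r (ltW T0) cN; lra.
have h : (u + v) * (w + x) <= (M + P / 18) * (M + P / 18).
  by apply: ler_pM; rewrite ?addr_ge0 // lerD // out.
apply: (le_lt_trans h _).
have q1 : 0 <= (3 * M - P) * (2 * P - 3 * M) by rewrite mulr_ge0 // subr_ge0.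
have q2 : 0 < P * P by rewrite mulr_gt0.
have q3 : 0 <= P * (2 * P - 3 * M) by rewrite mulr_ge0 ?subr_ge0 // ltW.
by lra.
Qed.

(** An outside element of either family confines the inside part of the other to an [extA], of size
    [M] at most two thirds of [P]. The outside parts are at most [P / 18], and (M + P/18)^2 < M
    P. *)
Lemma both_out (c : rat) : 0 < c ->
  exists n0, forall n, (n0 <= n)%N -> forall (A B : {set {perm 'I_n.+2}}) k l,
    cross_intersecting A B ->
    c * (n.+1`!)%:R <= #|A :&: one_coset k l|%:R ->
    c * (n.+1`!)%:R <= #|B :&: one_coset k l|%:R ->
    ~~ (A \subset one_coset k l) -> ~~ (B \subset one_coset k l) ->
    (#|A| * #|B| < ((n.+1)`! - derangements n.+1 - derangements n) * ((n.+1)`! + 1))%N.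
Proof.
move=> c0; have [n0 hn0] := eventually_ge_mul 648 c0.
exists (n0 + 7)%N => n hn A B k l cAB hA hB /subsetPn[r1 r1A r1C] /subsetPn[r2 r2B r2C].
have [n7 n2 le0] : [/\ 7 <= n, 2 <= n & n0 <= n.+1]%N by clear -hn; split; lia.
have {}hn0 := hn0 _ le0.
have outA := outside_le n7 cAB hB.
have outB := outside_le n7 (cross_sym cAB) hA.
have [M1 M2] := extA_card_bounds n2.
move: r1C r2C; rewrite !inE => r1C r2C.
have AM := subset_leq_card (cross_subset_extA k l cAB r2B).
have BM := subset_leq_card (cross_subset_extA k l (cross_sym cAB) r1A).
rewrite (card_extA r2C) in AM; rewrite (card_extA r1C) in BM.
rewrite -(ltr_nat rat) (natrM _ #|A|) (natrM _ (_ - _)) (natrD _ _ 1).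
rewrite -(ler_nat rat) in AM; rewrite -(ler_nat rat) in BM.
rewrite -(ler_nat rat) (natrM _ 3) in M1; rewrite -(ler_nat rat) (natrM _ 3) (natrM _ 2) in M2.
apply: (numeric_both_out c0 _ _ hn0 M1 M2 (ler0n _ _) (ler0n _ _) (ler0n _ _) (ler0n _ _)
  (card_split_coset A k l) (card_split_coset B k l) AM BM outA outB).
  by rewrite ltr0n fact_gt0.
by rewrite factS natrM.
Qed.

Lemma numeric_start (F : realFieldType) (a b P M : F) :
  0 < P -> 0 <= b -> b <= a -> P <= 3 * M -> M * (P + 1) <= a * b -> a * b <= 36 * P ^+ 2 ->
  [/\ 3^-1 * P ^+ 2 <= a * b, b <= 6 * P & P <= 2 * a].
Proof.
move=> P0 b0 ba M1 h1 h2.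
have q : P * P <= 3 * M * P by rewrite ler_pM2r.
have q1 : 3^-1 * P ^+ 2 <= a * b by lra.
have a0 : 0 <= a := le_trans b0 ba.
have bb : b * b <= a * b by exact: ler_wpM2r.
have ab : a * b <= a * a by exact: ler_wpM2l.
split => //.
  by rewrite -ler_sqr ?nnegrE ?mulr_ge0 ?ler0n ?(ltW P0) // exprMn !expr2; lra.
by rewrite -ler_sqr ?nnegrE ?mulr_ge0 ?ler0n ?(ltW P0) // exprMn !expr2; lra.
Qed.

Lemma numeric_dense (F : realFieldType) (c P T N a u v : F) :
  0 < c -> c <= 3^-1 -> 0 < T -> P = N * T -> 216 <= c * N ->
  P <= 2 * a -> a = u + v -> c * v <= 36 * T -> c * P <= u.
Proof.
move=> c0 c1 T0 PE cN ha aE hv; rewrite aE in ha.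
have N0 : 0 < N by rewrite -(pmulr_rgt0 _ c0); lra.
have P0 : 0 < P by rewrite PE mulr_gt0.
have vP : v <= P / 6.
  rewrite -(ler_pM2l c0); apply: (le_trans hv _); rewrite PE.
  by have := ler_wpM2r (ltW T0) cN; lra.
have := ler_wpM2r (ltW P0) c1; lra.
Qed.

(** As [M] is at least [P / 3], the density [eps] is 1/3. The smaller family [B] is dense in a
    coset, [outside_le] then makes [A] dense in it, and the cases are which families are contained
    in that coset. *)
Lemma extremal_wlog : exists n0, forall n, (n0 <= n)%N ->
  forall A B : {set {perm 'I_n.+2}}, cross_intersecting A B ->
  ~ (exists i j, A \subset one_coset i j /\ B \subset one_coset i j) ->
  (((n.+1)`! - derangements n.+1 - derangements n) * ((n.+1)`! + 1) <= #|A| * #|B|)%N ->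
  (#|B| <= #|A|)%N ->
  exists i j (r : {perm 'I_n.+2}), r i != j /\ ((A = extA i j r /\ B = extB i j r) \/
                             (A = extB i j r /\ B = extA i j r)).
Proof.
have e0 : 0 < 3^-1 :> rat by rewrite invr_gt0.
have e1 : 3^-1 <= 1 :> rat by rewrite invf_le1.
have [c [c0 c1 [n1 h1]]] := dense_coset e0 e1.
have [n2 h2] := eventually_ge_mul 216 c0.
have [n3 h3] := one_side c0 c1.
have [n4 h4] := both_out c0.
exists (n1 + n2 + n3 + n4 + 7)%N => n hn A B cAB nc big ba.
have [le1 le2 le3 le4] : [/\ n1 <= n.+1, n2 <= n.+1, n3 <= n & n4 <= n]%N
  by clear -hn; split; lia.
have [n7 n7'] : (7 <= n /\ 2 <= n)%N by clear -hn; split; lia.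
move: (h1 _ le1) (h2 _ le2) (h3 _ le3) (h4 _ le4) => {}h1 {}h2 {}h3 {}h4.
have [M1 M2] := extA_card_bounds n7'.
have P0 : 0 < ((n.+1)`!)%:R :> rat by rewrite ltr0n fact_gt0.
have T0 : 0 < (n`!)%:R :> rat by rewrite ltr0n fact_gt0.
have PE : ((n.+1)`!)%:R = (n.+1)%:R * (n`!)%:R :> rat by rewrite factS natrM.
have bigr : ((n.+1)`! - derangements n.+1 - derangements n)%:R * ((n.+1)`!%:R + 1)
    <= #|A|%:R * #|B|%:R :> rat.
  by rewrite -(natrD _ _ 1) -!natrM ler_nat.
rewrite -(ler_nat rat) (natrM _ 3) in M1.
have bar : #|B|%:R <= #|A|%:R :> rat by rewrite ler_nat.
have cb := cross_bound (leqW n7) cAB.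
have [s1 s2 s3] := numeric_start P0 (ler0n _ _) bar M1 bigr cb.
have [k [l hB]] := h1 A B cAB s1 s2.
have out := outside_le n7 cAB hB.
have hA := numeric_dense c0 c1 T0 PE h2 s3 (card_split_coset A k l) out.
clear h1 h2 s1 s2 s3 cb bigr bar out M1 M2 e0 e1.
have [sA|sA] := boolP (A \subset one_coset k l).
  have [sB|sB] := boolP (B \subset one_coset k l); first by case: nc; exists k, l.
  have [r [rkl -> ->]] := h3 A B k l cAB hA sA sB big.
  by exists k, l, r; split => //; left.
have [sB|sB] := boolP (B \subset one_coset k l).
  rewrite [(#|A| * _)%N]mulnC in big.
  have [r [rkl -> ->]] := h3 B A k l (cross_sym cAB) hB sB sA big.
  by exists k, l, r; split => //; right.
by have := h4 A B k l cAB hA hB sA sB; rewrite ltnNge big.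
Qed.

End EndGame.

Theorem theorem10 :
  exists n0 : nat, forall n : nat, n0 <= n ->
  forall A B : {set {perm 'I_n}},
    cross_intersecting A B ->
    ~ (exists i j : 'I_n, A \subset one_coset i j /\ B \subset one_coset i j) ->
    (#|A| * #|B| <= ((n.-1)`! - derangements n.-1 - derangements n.-2)
                      * ((n.-1)`! + 1))%N
    /\
    ((#|A| * #|B| = ((n.-1)`! - derangements n.-1 - derangements n.-2)
                      * ((n.-1)`! + 1))%N
     <->
     exists (i j : 'I_n) (r : {perm 'I_n}), r i != j /\
       ((A = extA i j r /\ B = extB i j r) \/
        (A = extB i j r /\ B = extA i j r))).
Proof.
(* The shift by two makes the predecessors [n.-1] and [n.-2] genuine. *)
have [n0 h] := extremal_wlog; exists n0.+2 => -[|[|n]] // hn A B cAB nc.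
move: (h n hn) => {}h; rewrite !succnK.
set M := (_ - _ - _)%N.
have ext : M * ((n.+1)`! + 1) <= #|A| * #|B| ->
    exists (i j : 'I_n.+2) (r : {perm 'I_n.+2}), r i != j /\
       ((A = extA i j r /\ B = extB i j r) \/ (A = extB i j r /\ B = extA i j r)).
  move=> big; have [ba|/ltnW ab] := leqP #|B| #|A|; first exact: h.
  have [||i [j [r [rij [[-> ->]|[-> ->]]]]]] := h B A (cross_sym cAB) _ _ ab.
  - by move=> [i [j [sB sA]]]; apply: nc; exists i, j.
  - by rewrite mulnC (mulnC #|B|) mulnC.
  - by exists i, j, r; split => //; right.
  - by exists i, j, r; split => //; left.
have card_ext (i j : 'I_n.+2) (r : {perm 'I_n.+2}) : r i != j ->
    (A = extA i j r /\ B = extB i j r) \/ (A = extB i j r /\ B = extA i j r) ->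
    #|A| * #|B| = M * ((n.+1)`! + 1).
  move=> rij [] [-> ->]; rewrite card_extA // card_extB //.
  by rewrite mulnC.
split.
  rewrite leqNgt; apply/negP => big.
  have [i [j [r [rij str]]]] := ext (ltnW big).
  by move: big; rewrite (card_ext i j r rij str) ltnn.
split=> [eq|[i [j [r [rij str]]]]]; last exact: card_ext str.
by apply: ext; rewrite eq.
Qed.
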